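(* Let $V=V(T)$ be any function that tends to infinity as $T\to\infty$. Then, as $T\to\infty$, $$\mathbb{P}\Big(\max_{|t-u|\le 1}|\zeta(\tfrac12+\mathrm{i}u)|>V\log T\Big)=O(1/V^2)=o(1).$$
   Context: $\zeta$ is the Riemann zeta function. Here $t$ is a uniform random variable on $[T,2T]$, so that for a condition $A$ on $t$, $\mathbb{P}(A)=\frac1T\,\mathrm{meas}\{t\in[T,2T]: A \text{ holds for } t\}$ with $\mathrm{meas}$ the Lebesgue measure. The maximum is over real $u$ with $|t-u|\le1$. *)

(* Defs.v *)
From HB Require Import structures.
From mathcomp Require Import all_boot all_order all_algebra.
From mathcomp Require Import all_classical all_reals all_analysis.
From mathcomp.real_closed Require Import complex.

Set Implicit Arguments.
Unset Strict Implicit.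
Unset Printing Implicit Defensive.

Import Order.TTheory GRing.Theory Num.Theory.
Import numFieldNormedType.Exports.

Local Open Scope classical_set_scope.
Local Open Scope ring_scope.
Local Open Scope complex_scope.

(* lets the Landau notations be used with the filter +oo *)
Canonical pinfty_filter_on (R : realType) :=
  FilterType (pinfty_nbhs R) (@filter_filter R _ proper_pinfty_nbhs).

(* [R[i]^o] is [R[i]] as a normed module over itself; it carries the topology
   of the complex modulus, with respect to which the limits below are taken. *)

Definition cexp (R : realType) (z : R[i]) : R[i] :=
  (expR (complex.Re z) * cos (complex.Im z)) +i*
  (expR (complex.Re z) * sin (complex.Im z)).

(* n ^ (- s), meaningful for 0 < n *)
Definition nat_cpowN (R : realType) (n : nat) (s : R[i]) : R[i] :=
  cexp (- s * (ln (n%:R : R))%:C).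

(* f is the sum of a convergent power series on some disc centred at z *)
Definition analytic_at (R : realType) (f : R[i] -> R[i]) (z : R[i]) : Prop :=
  exists2 r : R, 0 < r &
  exists a : nat -> R[i], forall w : R[i], Normc.normc (w - z) < r ->
    series (fun n => a n * (w - z) ^+ n : R[i]^o) @ \oo --> (f w : R[i]^o).

(* zeta is the analytic continuation to C \ {1} of the Dirichlet series
   \sum_(n >= 1) n ^ (- s), 1 < Re s. By the identity theorem this determines
   zeta everywhere except at the pole 1, where its value is irrelevant. *)
Definition is_riemann_zeta (R : realType) (zeta : R[i] -> R[i]) : Prop :=
  (forall s : R[i], 1 < complex.Re s ->
     series (fun n => nat_cpowN n.+1 s : R[i]^o) @ \oo --> (zeta s : R[i]^o)) /\
  (forall s : R[i], s != 1 -> analytic_at zeta s).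

(* The supremum is a maximum: u |-> zeta (1/2 + i u) is continuous and the
   range of u is compact. *)
Definition max_near (R : realType) (zeta : R[i] -> R[i]) (t : R) : R :=
  sup [set Normc.normc (zeta (2^-1 +i* u)) | u in [set u : R | `|t - u| <= 1]].

(* the probability that A holds for a uniform random point of [T, 2T], 0 < T *)
Definition prob_unif (R : realType) (T : R) (A : set R) : R :=
  T^-1 * fine (lebesgue_measure (`[T, 2 * T] `&` A)).

(* Main.v *)
Require Import Defs.
From HB Require Import structures.
From mathcomp Require Import all_boot all_order all_algebra.
From mathcomp Require Import all_classical all_reals all_analysis.
From mathcomp.real_closed Require Import complex.
From mathcomp Require Import ring lra.

Set Implicit Arguments.
Unset Strict Implicit.
Unset Printing Implicit Defensive.

Import Order.TTheory GRing.Theory Num.Theory.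
Import numFieldNormedType.Exports.

Local Open Scope classical_set_scope.
Local Open Scope ring_scope.
Local Open Scope complex_scope.

(** The statement follows from Chebyshev's inequality and a discrete form of the
    maximal second moment bound
    [\int_T^(2T) max_(|t-u| <= 1) |zeta(1/2 + iu)|^2 dt = O(T (log T)^2)],
    which is proved with finite sums and explicit antiderivatives.

    Continuation.  For [Re s > 1] one has [(1 - 2^(1-s)) zeta(s) = eta(s)],
    where [eta(s)] is the sum of the pairs [(2n+1)^(-s) - (2n+2)^(-s)], and
    these pairs still converge absolutely at [Re s = 1/2].  Both sides have
    Taylor expansions along a horizontal line, so the identity propagates to
    the left by the identity theorem in one real variable ([taylor_eq0]); the
    line must avoid the pole, hence [u != 0] in [etaz_half].

    Truncation.  If [N >= |u|], the ratio of two consecutive terms of the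
    alternating series beyond [N] stays in the left half plane and varies slowly,
    so Abel summation bounds the tail by a constant ([sum_altterm_tail]).  Hence,
    on the critical line, [|zeta|] is at most a constant times [|D(u)| + 5], with
    [D] the alternating Dirichlet polynomial of length [N], and [N] may be taken
    of order [T].

    Mean square.  [|D|^2] is a trigonometric sum with an explicit antiderivative.
    Its diagonal contributes [T log N], and each off-diagonal term oscillates by
    at most [2 / (sqrt(mn) |log(m/n)|)]; the inequality
    [1 / (sqrt(mn) log(n/m)) <= 1/m + 1/(n-m)] makes their total [O(N log N)]
    ([dsqprim_osc]).  The same bound for [D'] costs a factor [(log N)^2].

    Maximum.  A Sobolev inequality bounds [|D|^2] at a point of an interval by
    the increment over that interval of one fixed function, whose derivative is
    essentially [log N |D|^2 + |D'|^2 / log N] ([dsq_sobolev]).  Cutting [[T, 2T]]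
    into unit intervals, these increments telescope to [O(T (log T)^2)], and
    counting the intervals on which [|zeta|] exceeds [V log T] somewhere gives
    [O(T / V^2)] ([prob_large_values]).  The exceptional set is covered by the
    counted intervals, and Lebesgue outer measure is monotone and subadditive. *)

(** * A Sobolev inequality for trigonometric polynomials *)

Section MeanSquare.
Variable R : realType.
Implicit Types (a l : nat -> R) (N m n : nat) (x y u : R).

Lemma mean_value (f df : R -> R) x y :
  (forall u, is_derive u 1 f (df u)) -> x <= y ->
  exists2 c, x <= c <= y & f y - f x = df c * (y - x).
Proof.
move=> fP xy.
have [|c cxy e] := @MVT_segment _ f df x y xy (fun u _ => fP u).
  by apply: derivable_within_continuous => u _; apply: ex_derive.
by exists c => //; rewrite in_itv in cxy.
Qed.

Lemma nondecreasing_of_derive (f df : R -> R) x y :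
  (forall u, is_derive u 1 f (df u)) -> (forall u, 0 <= df u) -> x <= y ->
  f x <= f y.
Proof.
move=> fP df0 xy; have [c _ e] := mean_value fP xy.
by rewrite -subr_ge0 e mulr_ge0 ?subr_ge0.
Qed.

(** [dcos] and [- dsin] are the real and imaginary parts of
    [\sum_n a_n e^(- i u l_n)], and [dsq] is its squared modulus. *)
Definition dcos a l N u := \sum_(n < N) a n * cos (u * l n).
Definition dsin a l N u := \sum_(n < N) a n * sin (u * l n).
Definition dsq a l N u := dcos a l N u ^+ 2 + dsin a l N u ^+ 2.

(** Antiderivative of [u |-> cos (u x)]; the frequency 0, which produces the
    diagonal terms of the mean square, needs the separate clause. *)
Definition cosprim x u := if x == 0 then u else sin (u * x) / x.

Definition dsqprim a l N u :=
  \sum_(m < N) \sum_(n < N) a m * a n * cosprim (l m - l n) u.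

Lemma is_derive_cosprim x u : is_derive u 1 (cosprim x) (cos (u * x)).
Proof.
rewrite /cosprim; have [->|x0] := eqVneq x 0.
  by rewrite mulr0 cos0; exact: is_derive_id.
apply: is_derive_eq.
rewrite /GRing.scale /=.
by field.
Qed.

Lemma dsqE a l N u :
  dsq a l N u = \sum_(m < N) \sum_(n < N) a m * a n * cos (u * (l m - l n)).
Proof.
rewrite /dsq /dcos /dsin !expr2 !big_distrlr/= -big_split/=.
apply: eq_bigr => m _; rewrite -big_split/=; apply: eq_bigr => n _.
by rewrite mulrBr cosB; ring.
Qed.

Lemma is_derive_dsqprim a l N u :
  is_derive u 1 (dsqprim a l N) (dsq a l N u).
Proof.
rewrite dsqE /dsqprim.
have -> : (fun u => \sum_(m < N) \sum_(n < N) a m * a n * cosprim (l m - l n) u)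
  = \sum_(m < N) \sum_(n < N) (a m * a n *: cosprim (l m - l n) : R -> R).
  apply/funext => v; rewrite fct_sumE; apply: eq_bigr => m _.
  by rewrite fct_sumE; apply: eq_bigr => n _.
apply: is_derive_sum => m; apply: is_derive_sum => n.
by apply: is_deriveZ; apply: is_derive_cosprim.
Qed.


(** Differentiating in [u] multiplies the [n]-th coefficient by [l_n], up to a
    rotation of the complex plane that the squared modulus ignores. *)
Definition dwt a l n := a n * l n.

Lemma is_derive_dcos a l N u :
  is_derive u 1 (dcos a l N) (- dsin (dwt a l) l N u).
Proof.
rewrite /dcos /dsin.
have -> : (fun u => \sum_(n < N) a n * cos (u * l n))
  = \sum_(n < N) (a n *: (fun u => cos (u * l n)) : R -> R).
  by apply/funext => v; rewrite fct_sumE.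
rewrite -sumrN.
apply: is_derive_sum => n; rewrite /dwt.
apply: is_derive_eq; rewrite /GRing.scale /=.
by ring.
Qed.

Lemma is_derive_dsin a l N u :
  is_derive u 1 (dsin a l N) (dcos (dwt a l) l N u).
Proof.
rewrite /dcos /dsin.
have -> : (fun u => \sum_(n < N) a n * sin (u * l n))
  = \sum_(n < N) (a n *: (fun u => sin (u * l n)) : R -> R).
  by apply/funext => v; rewrite fct_sumE.
apply: is_derive_sum => n; rewrite /dwt.
apply: is_derive_eq; rewrite /GRing.scale /=.
by ring.
Qed.

Definition dsq_der a l N u := 2 * (dsin a l N u * dcos (dwt a l) l N u
   - dcos a l N u * dsin (dwt a l) l N u).

Lemma is_derive_dsq a l N u : is_derive u 1 (dsq a l N) (dsq_der a l N u).
Proof.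
have dc := is_derive_dcos a l N u; have ds := is_derive_dsin a l N u.
rewrite /dsq.
apply: is_derive_eq; rewrite /GRing.scale /= /dsq_der.
by ring.
Qed.

Lemma dsq_ge0 a l N u : 0 <= dsq a l N u.
Proof. by rewrite addr_ge0 ?sqr_ge0. Qed.

(** [2 |D D'| <= L |D|^2 + |D'|^2 / L]: the weight [L], to be taken of the order of
    the frequencies, balances the mean squares of [D] and [D']. *)
Lemma dsq_der_le a l N u (L : R) : 0 < L ->
  `|dsq_der a l N u| <= L * dsq a l N u + dsq (dwt a l) l N u / L.
Proof.
move=> L0; rewrite /dsq_der /dsq.
move: (dcos a l N u) (dsin a l N u) => p q.
move: (dcos _ l N u) (dsin _ l N u) => s r.
have L1 : L != 0 by rewrite gt_eqF.
rewrite ler_norml; apply/andP; split; rewrite -subr_ge0.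
  rewrite (_ : _ - _ = ((L * q + s) ^+ 2 + (L * p - r) ^+ 2) / L); last by field.
  by rewrite divr_ge0 ?addr_ge0 ?sqr_ge0 ?ltW.
rewrite (_ : _ - _ = ((L * q - s) ^+ 2 + (L * p + r) ^+ 2) / L); last by field.
by rewrite divr_ge0 ?addr_ge0 ?sqr_ge0 ?ltW.
Qed.

(** A function whose derivative is [(k + L) |D|^2 + |D'|^2 / L].  Its increments
    control [|D|^2] pointwise, and increments of a single function telescope. *)
Definition dmaj a l N (k L u : R) :=
  (k + L) * dsqprim a l N u + dsqprim (dwt a l) l N u / L.

Lemma is_derive_dmaj a l N k L u : is_derive u 1 (dmaj a l N k L)
  ((k + L) * dsq a l N u + dsq (dwt a l) l N u / L).
Proof.
have d1 := is_derive_dsqprim a l N u.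
have d2 := is_derive_dsqprim (dwt a l) l N u.
rewrite /dmaj.
apply: is_derive_eq; rewrite /GRing.scale /=.
by ring.
Qed.

(** Some point [c] of the interval carries exactly the mean value of [|D|^2],
    and the variation of [|D|^2] between [c] and [u] is at most the integral of
    [L |D|^2 + |D'|^2 / L].  The latter is used through the monotonicity of
    [G + |D|^2] and [G - |D|^2], where [G] is an antiderivative of it. *)
Lemma dsq_sobolev a l N (L x y u : R) : 0 < L -> x < y -> x <= u <= y ->
  dsq a l N u <= dmaj a l N (y - x)^-1 L y - dmaj a l N (y - x)^-1 L x.
Proof.
move=> L0 xy /andP[xu uy].
have yx0 : 0 < y - x by rewrite subr_gt0.
have [c /andP[xc cy] Pc] := mean_value (is_derive_dsqprim a l N) (ltW xy).
set G := dmaj a l N 0 L.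
have dG := is_derive_dmaj a l N 0 L; rewrite -/G in dG.
have L0' : 0 <= L^-1 by rewrite invr_ge0 ltW.
have Gmono v w : v <= w -> G v <= G w.
  apply: (nondecreasing_of_derive dG) => z.
  by rewrite add0r addr_ge0 ?mulr_ge0 ?dsq_ge0 // ltW.
have dGD (v : R) : is_derive v 1 (G \+ dsq a l N)
   (0 + L * dsq a l N v + dsq (dwt a l) l N v / L + dsq_der a l N v).
  have h1 := dG v; have h2 := is_derive_dsq a l N v.
  by apply: is_derive_eq; rewrite !add0r.
have dGB (v : R) : is_derive v 1 (G \- dsq a l N)
   (0 + L * dsq a l N v + dsq (dwt a l) l N v / L - dsq_der a l N v).
  have h1 := dG v; have h2 := is_derive_dsq a l N v.
  by apply: is_derive_eq; rewrite !add0r.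
have fG : dsq a l N u - dsq a l N c <= G y - G x.
  have [cu|/ltW uc] := lerP c u.
    have : (G \- dsq a l N) c <= (G \- dsq a l N) u.
      apply: (nondecreasing_of_derive dGB) => // z.
      rewrite add0r subr_ge0 (le_trans _ (dsq_der_le a l N z L0)) //.
      exact: ler_norm.
    by have := Gmono _ _ uy; have := Gmono _ _ xc => /=; lra.
  have : (G \+ dsq a l N) u <= (G \+ dsq a l N) c.
    apply: (nondecreasing_of_derive dGD) => // z.
    rewrite add0r -[dsq_der _ _ _ _]opprK subr_ge0.
    rewrite (le_trans _ (dsq_der_le a l N z L0)) // -normrN.
    exact: ler_norm.
  by have := Gmono _ _ xu; have := Gmono _ _ cy => /=; lra.
have -> : dmaj a l N (y - x)^-1 L y - dmaj a l N (y - x)^-1 L x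
   = dsq a l N c + (G y - G x).
  have -> : dsq a l N c = (dsqprim a l N y - dsqprim a l N x) / (y - x).
    by rewrite Pc mulfK ?gt_eqF.
  by rewrite /G /dmaj; ring.
by lra.
Qed.

End MeanSquare.

(** * Mean square of Dirichlet polynomials with coefficients of size 1/sqrt n *)

Section MeanSquareBound.
Variable R : realType.
Implicit Types (a l : nat -> R) (N m n : nat) (x y u : R).

Lemma ln_subr_ge (p q : R) : 0 < p -> 0 < q -> (q - p) / q <= ln q - ln p.
Proof.
move=> p0 q0.
have h : ln (p / q) <= p / q - 1.
  rewrite {1}(_ : p / q = 1 + (p / q - 1)); last by lra.
  by rewrite le_ln1Dx // -subr_gt0 opprK addrNK divr_gt0.
rewrite ln_div // in h.
have -> : (q - p) / q = 1 - p / q by field; rewrite gt_eqF.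
by lra.
Qed.

Lemma ln_subr_le (p q : R) : 0 < p -> 0 < q -> ln q - ln p <= (q - p) / p.
Proof.
move=> p0 q0; have := ln_subr_ge q0 p0.
by rewrite -[q - p]opprB mulNr; lra.
Qed.

Definition harm N : R := \sum_(k < N) (k.+1%:R)^-1.

Lemma harm_ge0 N : 0 <= harm N.
Proof. by apply: sumr_ge0 => k _; rewrite invr_ge0. Qed.

Lemma harmS N : harm N.+1 = harm N + (N.+1%:R)^-1.
Proof. by rewrite /harm big_ord_recr. Qed.

Lemma harm_le_ln N : harm N.+1 <= 1 + ln (N.+1%:R).
Proof.
elim: N => [|N IH]; first by rewrite harmS /harm big_ord0 ln1 invr1; lra.
rewrite harmS.
have h := @ln_subr_ge N.+1%:R N.+2%:R (ltr0Sn _ _) (ltr0Sn _ _).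
have e : N.+2%:R - N.+1%:R = 1 :> R by rewrite -[N.+2%:R]natr1; ring.
by rewrite e div1r in h; move: (lerD IH h); rewrite -addrA subrKC.
Qed.

Definition lnS n : R := ln (n.+1%:R).

Lemma lnS_inj_lt m n : (m < n)%N -> lnS m < lnS n.
Proof. by move=> mn; rewrite ltr_ln ?posrE ?ltr0Sn // ltr_nat. Qed.

(** As [log (n/m) >= (n-m)/n] and [sqrt (mn) >= m], the left-hand side is at most
    [n / (m (n-m))], which splits into the two partial fractions; summed over
    all pairs up to [N] they give only [O(N log N)]. *)
Lemma log_gap m n : (m < n)%N ->
  (Num.sqrt m.+1%:R)^-1 * (Num.sqrt n.+1%:R)^-1 / (lnS n - lnS m)
    <= (m.+1%:R)^-1 + ((n - m)%:R)^-1 :> R.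
Proof.
move=> mn; rewrite natrB; last exact: ltnW.
rewrite -[n%:R - m%:R](_ : n.+1%:R - m.+1%:R = _); last by rewrite -!natr1; ring.
have h : m.+1%:R < n.+1%:R :> R by rewrite ltr_nat.
rewrite /lnS.
have p0 : 0 < m.+1%:R :> R by exact: ltr0Sn.
move: (m.+1%:R) (n.+1%:R) p0 h => p q p0 pq.
have q0 : 0 < q by exact: lt_trans pq.
have d0 : 0 < q - p by rewrite subr_gt0.
have -> : p^-1 + (q - p)^-1 = (p * ((q - p) / q))^-1.
  by field; rewrite !gt_eqF.
have g := ln_subr_ge p0 q0.
rewrite -!invfM lef_pV2 ?posrE; last 2 first.
- by rewrite !mulr_gt0 ?sqrtr_gt0 ?(lt_le_trans _ g) ?divr_gt0.
- by rewrite mulr_gt0 ?divr_gt0.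
rewrite ler_pM ?divr_ge0 ?(ltW p0) ?(ltW q0) ?(ltW d0) //.
rewrite -[leLHS](_ : Num.sqrt p * Num.sqrt p = p); last first.
  by rewrite -expr2 sqr_sqrtr ?(ltW p0).
by rewrite ler_wpM2l ?sqrtr_ge0 // ler_sqrt // ltW.
Qed.

Lemma cosprim_osc (c x y : R) : c != 0 ->
  `|cosprim c y - cosprim c x| <= 2 / `|c|.
Proof.
move=> c0; rewrite /cosprim (negPf c0) -mulrBl normrM normfV.
rewrite ler_wpM2r ?invr_ge0 ?normr_ge0 //.
rewrite (le_trans (ler_normB _ _)) //.
by have := sin_max (y * c); have := sin_max (x * c); lra.
Qed.

Lemma sum_rev_harm N : \sum_(m < N) ((N - m)%:R)^-1 = harm N.
Proof.
rewrite /harm (reindex_inj rev_ord_inj) /=; apply: eq_bigr => k _.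
by rewrite subKn.
Qed.

(** Contribution of the pair [(m, n)] to the mean square over [[x, y]]. *)
Definition oscterm a x y m n : R := a m * a n *
  (cosprim (lnS m - lnS n) y - cosprim (lnS m - lnS n) x).

Lemma oscterm_sym a x y m n : oscterm a x y m n = oscterm a x y n m.
Proof.
rewrite /oscterm -[lnS m - lnS n]opprB [a m * a n]mulrC; congr (_ * _).
rewrite /cosprim oppr_eq0; case: eqP => // _.
by rewrite !mulrN !sinN !invrN !mulrNN.
Qed.

Lemma oscterm_off a (A : R) x y m n : 0 <= A -> (m < n)%N ->
  `|a m| <= A / Num.sqrt m.+1%:R -> `|a n| <= A / Num.sqrt n.+1%:R ->
  oscterm a x y m n <= A ^+ 2 * (2 * ((m.+1%:R)^-1 + ((n - m)%:R)^-1)).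
Proof.
move=> A0 mn am an; apply: (le_trans (ler_norm _)); rewrite /oscterm !normrM.
have c0 : lnS m - lnS n < 0 by rewrite subr_lt0 lnS_inj_lt.
have := cosprim_osc x y (ltr0_neq0 c0); rewrite (ltr0_norm c0) opprB => h.
apply: le_trans (_ : A / Num.sqrt m.+1%:R * (A / Num.sqrt n.+1%:R) *
   (2 / (lnS n - lnS m)) <= _).
  by rewrite !ler_pM ?mulr_ge0.
rewrite [leLHS](_ : _ = A ^+ 2 * (2 * ((Num.sqrt m.+1%:R)^-1 *
  (Num.sqrt n.+1%:R)^-1 / (lnS n - lnS m)))); last by ring.
by rewrite ler_wpM2l ?sqr_ge0 // ler_wpM2l // log_gap.
Qed.

Lemma oscterm_diag a (A : R) x y n : 0 <= A -> x <= y ->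
  `|a n| <= A / Num.sqrt n.+1%:R ->
  oscterm a x y n n <= A ^+ 2 * ((y - x) / n.+1%:R).
Proof.
move=> A0 xy an; rewrite /oscterm subrr /cosprim eqxx [leRHS](_ : _ =
  (A / Num.sqrt n.+1%:R) ^+ 2 * (y - x)); last first.
  rewrite exprMn exprVn sqr_sqrtr //; ring.
rewrite ler_wpM2r ?subr_ge0 // -expr2 -real_normK ?num_real //.
by rewrite lerXn2r ?nnegrE ?mulr_ge0 ?invr_ge0 ?sqrtr_ge0.
Qed.

(** Passing from [N] to [N + 1] adds one diagonal term and the two strips
    [(m, N)] and [(N, m)], each of which sums to at most [4 A^2 harm N]. *)
Lemma dsqprim_osc a (A : R) N x y : 0 <= A -> x <= y ->
  (forall n, (n < N)%N -> `|a n| <= A / Num.sqrt n.+1%:R) ->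
  dsqprim a lnS N y - dsqprim a lnS N x
    <= A ^+ 2 * ((y - x + 8 * N%:R) * harm N).
Proof.
move=> A0 xy.
have -> : dsqprim a lnS N y - dsqprim a lnS N x =
   \sum_(m < N) \sum_(n < N) oscterm a x y m n.
  rewrite /dsqprim -sumrB; apply: eq_bigr => m _.
  by rewrite -sumrB; apply: eq_bigr => n _; rewrite /oscterm mulrBr.
elim: N => [|N IH] aA; first by rewrite big_ord0 /harm big_ord0 !mulr0.
have {}IH := IH (fun n nN => aA n (ltnW nN)).
rewrite big_ord_recr/= big_ord_recr/=.
under eq_bigr do rewrite big_ord_recr/=.
rewrite big_split/=.
have off : \sum_(m < N) oscterm a x y m N <= A ^+ 2 * (4 * harm N).
  apply: le_trans (_ : \sum_(m < N)
      A ^+ 2 * (2 * ((m.+1%:R)^-1 + ((N - m)%:R)^-1)) <= _).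
    apply: ler_sum => m _; have mN := ltn_ord m.
    by apply: oscterm_off; rewrite // aA // ltnS ltnW.
  rewrite -mulr_sumr -mulr_sumr big_split/= sum_rev_harm -/(harm N).
  by rewrite ler_wpM2l ?sqr_ge0 //; lra.
have off' : \sum_(m < N) oscterm a x y N m <= A ^+ 2 * (4 * harm N).
  by under eq_bigr do rewrite oscterm_sym.
have diag := oscterm_diag A0 xy (aA N (ltnSn N)).
have : A ^+ 2 * ((y - x + 8 * N%:R) * harm N) +
   A ^+ 2 * (8 * harm N) + A ^+ 2 * ((y - x) / N.+1%:R)
   <= A ^+ 2 * ((y - x + 8 * N.+1%:R) * harm N.+1).
  rewrite -!mulrDr ler_wpM2l ?sqr_ge0 // harmS -[N.+1%:R]natr1.
  have : 0 <= (N%:R + 1)^-1 :> R by rewrite invr_ge0 addr_ge0.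
  have N0 : 0 <= N%:R :> R by [].
  move: (N%:R) N0 => M M0 M1; move: (harm N) => h.
  rewrite -subr_ge0 [X in 0 <= X](_ : _ = 8 * (M + 1) * (M + 1)^-1); last by ring.
  by rewrite !mulr_ge0 ?addr_ge0.
move=> B; apply: (le_trans _ B).
rewrite [A ^+ 2 * (8 * harm N)](_ : _ =
  A ^+ 2 * (4 * harm N) + A ^+ 2 * (4 * harm N)); last by ring.
have := lerD (lerD IH off) (lerD off' diag).
by rewrite !addrA.
Qed.

End MeanSquareBound.

(** * Modulus of the complex exponential *)

Section ComplexModulus.
Variable R : realType.
Implicit Types (z w s : R[i]) (x y u : R).
Local Notation normc := (@Normc.normc R).
Local Notation Re := (@complex.Re R).
Local Notation Im := (@complex.Im R).

Lemma normcD_le z w : normc (z + w) <= normc z + normc w.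
Proof. exact: (@le_normcD R z w). Qed.

Lemma normcN_eq z : normc (- z) = normc z.
Proof. exact: (@normcN R z). Qed.

Lemma normcB_le z w : normc (z - w) <= normc z + normc w.
Proof. by rewrite -[normc w]normcN_eq normcD_le. Qed.

Lemma normcB_sym z w : normc (z - w) = normc (w - z).
Proof. by rewrite -normcN_eq opprB. Qed.

Lemma normc_ge0 z : 0 <= normc z.
Proof. by case: z => a b /=; rewrite sqrtr_ge0. Qed.

Lemma normc_real x : normc x%:C = `|x|.
Proof. by rewrite /= expr0n addr0 sqrtr_sqr. Qed.

Lemma sqr_normcE z : normc z ^+ 2 = Re z ^+ 2 + Im z ^+ 2.
Proof. by case: z => a b /=; rewrite sqr_sqrtr ?addr_ge0 ?sqr_ge0. Qed.

Lemma normc_Re z : `|Re z| <= normc z.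
Proof.
rewrite -ler_sqr ?nnegrE ?normc_ge0 // real_normK ?num_real //.
by rewrite sqr_normcE lerDl sqr_ge0.
Qed.

Lemma normc_Im z : `|Im z| <= normc z.
Proof.
rewrite -ler_sqr ?nnegrE ?normc_ge0 // real_normK ?num_real //.
by rewrite sqr_normcE lerDr sqr_ge0.
Qed.

Lemma normc_le_ReIm z : normc z <= `|Re z| + `|Im z|.
Proof.
rewrite -ler_sqr ?nnegrE ?normc_ge0 ?addr_ge0 // sqr_normcE sqrrD.
rewrite !real_normK ?num_real // -addrA [X in _ <= _ + X]addrC addrA lerDl.
by rewrite mulrn_wge0 // mulr_ge0.
Qed.

Lemma normcX z n : normc (z ^+ n) = normc z ^+ n.
Proof.
elim: n => [|n IH]; first by rewrite !expr0 Normc.normc1.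
by rewrite !exprS Normc.normcM IH.
Qed.

Lemma normc_sum (I : Type) (r : seq I) (P : pred I) (F : I -> R[i]) :
  normc (\sum_(i <- r | P i) F i) <= \sum_(i <- r | P i) normc (F i).
Proof.
elim/big_ind2 : _ => //; first by rewrite Normc.normc0.
by move=> a x b y ha hb; apply: (le_trans (normcD_le _ _)); exact: lerD.
Qed.

Lemma cexpD z w : cexp (z + w) = cexp z * cexp w.
Proof.
case: z w => [a b] [c d]; rewrite /cexp /= expRD cosD sinD.
by apply/eqP; rewrite eq_complex /=; apply/andP; split; apply/eqP; ring.
Qed.

Lemma normc_cexp z : normc (cexp z) = expR (Re z).
Proof.
rewrite /cexp /= !exprMn -mulrDr cos2Dsin2 mulr1 sqrtr_sqr.
by rewrite ger0_norm ?expR_ge0.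
Qed.

Lemma abs_sin_le x : `|sin x| <= `|x|.
Proof.
wlog x0 : x / 0 <= x.
  move=> h; have [/h //|/ltW x0] := lerP 0 x.
  by have := h (- x); rewrite sinN !normrN oppr_ge0; exact.
have [c _] := mean_value (fun v => @is_derive_sin R v) x0.
rewrite sin0 !subr0 => ->; rewrite normrM ler_piMl //; exact: cos_max.
Qed.

Lemma cos_sub1_le x : `|cos x - 1| <= `|x|.
Proof.
wlog x0 : x / 0 <= x.
  move=> h; have [/h //|/ltW x0] := lerP 0 x.
  by have := h (- x); rewrite cosN !normrN oppr_ge0; exact.
have [c _] := mean_value (fun v => @is_derive_cos R v) x0.
rewrite cos0 !subr0 => ->; rewrite normrM normrN ler_piMl //; exact: sin_max.
Qed.

Lemma expR_sub_le x y : expR y - expR x <= (y - x) * expR y.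
Proof.
have := expR_ge1Dx (x - y); have := expR_ge0 y => y0 h.
have : (1 + (x - y)) * expR y <= expR (x - y) * expR y by rewrite ler_wpM2r.
by rewrite -expRD subrK; lra.
Qed.

(** Write [e^(a + ib) - 1 = (e^a - 1) + e^a (e^(ib) - 1)], where [e^a <= 1]. *)
Lemma cexp_sub1 z : Re z <= 0 ->
  normc (cexp z - 1) <= 2 * (`|Re z| + `|Im z|).
Proof.
move=> a0; have -> : cexp z - 1 =
    (expR (Re z) - 1)%:C + (expR (Re z))%:C * ((cos (Im z) - 1) +i* sin (Im z)).
  apply/eqP; rewrite /cexp eq_complex /=.
  by apply/andP; split; apply/eqP; ring.
move: (Re z) (Im z) a0 => a b a0.
apply: (le_trans (normcD_le _ _)); rewrite Normc.normcM !normc_real.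
rewrite (ger0_norm (expR_ge0 _)).
have e1 : expR a <= 1 by rewrite expR_le1.
have e2 : `|expR a - 1| <= `|a|.
  rewrite ler0_norm ?subr_le0 // ler0_norm //.
  by have := expR_ge1Dx a; lra.
have e3 := normc_le_ReIm ((cos b - 1) +i* sin b); rewrite /= in e3.
have := abs_sin_le b; have := cos_sub1_le b => e4 e5.
have : expR a * normc ((cos b - 1) +i* sin b) <= 1 * (2 * `|b|).
  by apply: ler_pM; rewrite ?expR_ge0 ?normc_ge0 //; rewrite /=; lra.
by have := normr_ge0 a; rewrite /=; lra.
Qed.

Lemma ReM_real s x : Re (s * x%:C) = Re s * x.
Proof. by case: s => a b /=; rewrite mulr0 subr0. Qed.

Lemma ImM_real s x : Im (s * x%:C) = Im s * x.
Proof. by case: s => a b /=; rewrite mulr0 add0r. Qed.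

Lemma ReN_eq s : Re (- s) = - Re s. Proof. by case: s. Qed.
Lemma ImN_eq s : Im (- s) = - Im s. Proof. by case: s. Qed.

Lemma cexp_sub1_real s x : 0 <= Re s -> 0 <= x ->
  normc (cexp (- s * x%:C) - 1) <= 2 * (Re s + `|Im s|) * x.
Proof.
move=> s0 x0; have h : Re (- s * x%:C) <= 0.
  by rewrite ReM_real ReN_eq mulNr oppr_le0 mulr_ge0.
apply: (le_trans (cexp_sub1 h)).
rewrite ReM_real ImM_real ReN_eq ImN_eq !normrM !normrN (ger0_norm x0).
by rewrite (ger0_norm s0) -mulrDl mulrA.
Qed.

End ComplexModulus.

(** * Tails of the alternating series *)

Section Alternating.
Variable R : realType.
Implicit Types (z w s : R[i]) (x y u : R).
Local Notation normc := (@Normc.normc R).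
Local Notation Re := (@complex.Re R).
Local Notation Im := (@complex.Im R).

Definition lngap n : R := lnS R n.+1 - lnS R n.

Lemma lngap_bounds n : (n.+2%:R)^-1 <= lngap n <= (n.+1%:R)^-1.
Proof.
have e : n.+2%:R - n.+1%:R = 1 :> R by rewrite -[n.+2%:R]natr1; ring.
have := @ln_subr_ge R n.+1%:R n.+2%:R (ltr0Sn _ _) (ltr0Sn _ _).
have := @ln_subr_le R n.+1%:R n.+2%:R (ltr0Sn _ _) (ltr0Sn _ _).
by rewrite e !div1r => h1 h2; rewrite /lngap /lnS h1 h2.
Qed.

Lemma lngapS_le n : lngap n.+1 <= lngap n.
Proof.
have /andP[h _] := lngap_bounds n; have /andP[_ h'] := lngap_bounds n.+1.
exact: le_trans h' h.
Qed.

Lemma lngap_ge0 n : 0 <= lngap n.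
Proof. by have /andP[h _] := lngap_bounds n; apply: le_trans h. Qed.

Definition altterm s n : R[i] := (-1) ^+ n * nat_cpowN n.+1 s.

Lemma normc_cpowN s n : normc (nat_cpowN n.+1 s) = expR (- Re s * lnS R n).
Proof. by rewrite /nat_cpowN normc_cexp ReM_real ReN_eq. Qed.

Lemma lnS_ge0 n : 0 <= lnS R n.
Proof. by rewrite ln_ge0 // ler1n. Qed.

Lemma normc_altterm s n : 0 <= Re s -> normc (altterm s n) <= 1.
Proof.
move=> s0; rewrite /altterm Normc.normcM normcX normcN_eq Normc.normc1 expr1n mul1r.
by rewrite normc_cpowN expR_le1 mulNr oppr_le0 mulr_ge0 ?lnS_ge0.
Qed.

(** Minus the ratio of two consecutive terms of the alternating series. *)
Definition stepratio s n : R[i] := cexp (- s * (lngap n)%:C).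

Lemma alttermS s n : altterm s n.+1 = - altterm s n * stepratio s n.
Proof.
rewrite /altterm exprS mulN1r !mulNr -mulrA; congr (- (_ * _)); rewrite /stepratio.
rewrite /nat_cpowN -cexpD -mulrDr -rmorphD /lngap; congr (cexp (_ * _%:C)).
by rewrite /lnS; ring.
Qed.

(** The phase of the ratio is [|Im s| log ((n+2)/(n+1)) <= 1 < pi/2], so the
    ratio has a nonnegative real part. *)
Lemma one_le_normc_1Dstep s n : `|Im s| <= n.+1%:R ->
  1 <= normc (1 + stepratio s n).
Proof.
move=> hs; apply: le_trans (normc_Re _); apply: le_trans (ler_norm _).
rewrite /stepratio /cexp /= lerDl mulr_ge0 ?expR_ge0 //.
rewrite -[complex.Im _]/(Im (- s * _)) ImM_real ImN_eq mulNr cosN.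
apply: cos_ge0_pihalf; rewrite -ler_norml.
apply: le_trans (_ : 1 <= _); last by rewrite pihalf_ge1.
rewrite normrM (ger0_norm (lngap_ge0 n)).
have /andP[_ h] := lngap_bounds n.
rewrite -(@mulfV _ (n.+1%:R : R)) ?pnatr_eq0 //.
by rewrite ler_pM ?lngap_ge0.
Qed.

(** With [q_n] the terms and [d_n = 1 / (1 + r_n)], [r_n] the step ratio, one has
    [q_n = d_n (q_n - q_(n+1))].  Summation by parts leaves two boundary terms
    and the total variation of [d], which is at most that of [r]; the latter
    telescopes because the logarithmic gaps decrease, and it is [O(|s| / N)]. *)
Lemma sum_altterm_tail s N M : 0 <= Re s -> `|Im s| <= N.+1%:R -> (N <= M)%N ->
  normc (\sum_(N <= n < M) altterm s n) <= 4 + 2 * Re s.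
Proof.
move=> s0 hs NM.
have big n : (N <= n)%N -> `|Im s| <= n.+1%:R.
  by move=> Nn; apply: (le_trans hs); rewrite ler_nat.
pose d n := (1 + stepratio s n)^-1.
have d1 n : (N <= n)%N -> normc (d n) <= 1.
  move=> Nn; rewrite Normc.normcV invf_le1 ?one_le_normc_1Dstep ?big //.
  exact: lt_le_trans ltr01 (one_le_normc_1Dstep (big _ Nn)).
have nz n : (N <= n)%N -> 1 + stepratio s n != 0.
  move=> Nn; apply/eqP => e; have := one_le_normc_1Dstep (big _ Nn).
  by rewrite e Normc.normc0 ler10.
have dq n : (N <= n)%N -> altterm s n = d n * (altterm s n - altterm s n.+1).
  move=> Nn; rewrite alttermS mulNr opprK -{2}[altterm s n]mulr1 -mulrDr.
  by rewrite mulrCA mulVf ?mulr1 ?nz.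
have dd n : (N <= n)%N ->
    normc (d n.+1 - d n) <= 2 * (Re s + `|Im s|) * (lngap n - lngap n.+1).
  move=> Nn; have Nn1 := leqW Nn.
  have -> : d n.+1 - d n = d n.+1 * d n * (stepratio s n - stepratio s n.+1).
    by rewrite /d; field; rewrite !nz.
  have -> : stepratio s n - stepratio s n.+1 =
     stepratio s n.+1 * (cexp (- s * (lngap n - lngap n.+1)%:C) - 1).
    by rewrite mulrBr mulr1 /stepratio -cexpD -mulrDr -rmorphD subrKC.
  have r1 : normc (stepratio s n.+1) <= 1.
    rewrite /stepratio normc_cexp ReM_real ReN_eq expR_le1 mulNr oppr_le0.
    by rewrite mulr_ge0 ?lngap_ge0.
  have g0 : 0 <= lngap n - lngap n.+1 by rewrite subr_ge0 lngapS_le.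
  apply: le_trans (cexp_sub1_real s0 g0).
  rewrite !Normc.normcM mulrA ler_piMl ?normc_ge0 //.
  by rewrite !mulr_ile1 ?mulr_ge0 ?normc_ge0 ?d1.
(* Adding [d M * q_M] to the partial sum makes its increment
   [(d (M+1) - d M) q_(M+1)], which is small. *)
have key : normc (\sum_(N <= n < M) altterm s n + d M * altterm s M)
    <= 1 + 2 * (Re s + `|Im s|) * (lngap N - lngap M).
  rewrite -(subnKC NM); elim: (M - N)%N => [|k IH].
    rewrite addn0 big_geq // add0r subrr mulr0 addr0 Normc.normcM.
    by rewrite mulr_ile1 ?normc_ge0 // ?d1 // normc_altterm.
  have Nk : (N <= N + k)%N by rewrite leq_addr.
  rewrite addnS; move: (N + k)%N Nk IH => {}M {}NM IH.
  rewrite big_nat_recr //=.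
  have -> : \sum_(N <= n < M) altterm s n + altterm s M + d M.+1 * altterm s M.+1
    = \sum_(N <= n < M) altterm s n + d M * altterm s M +
      (d M.+1 - d M) * altterm s M.+1.
    by rewrite {1}(dq M NM); ring.
  apply: (le_trans (normcD_le _ _)).
  have h : normc ((d M.+1 - d M) * altterm s M.+1) <=
      2 * (Re s + `|Im s|) * (lngap M - lngap M.+1).
    apply: le_trans (dd M NM); rewrite Normc.normcM ler_piMr ?normc_ge0 //.
    exact: normc_altterm.
  apply: (le_trans (lerD IH h)).
  by rewrite -addrA -mulrDr addrA subrK.
have [gM gN] : 0 <= lngap M /\ lngap N <= (N.+1%:R)^-1.
  by have /andP[_] := lngap_bounds N; split; rewrite ?lngap_ge0.
have q : (Re s + `|Im s|) * (lngap N - lngap M) <= Re s + 1.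
  have N1 : (N.+1%:R)^-1 <= 1 :> R by rewrite invf_le1 ?ltr0Sn ?ler1n.
  apply: le_trans (_ : (Re s + `|Im s|) * (N.+1%:R)^-1 <= _).
    by rewrite ler_wpM2l ?addr_ge0 // lerBlDr (le_trans gN) ?lerDl.
  rewrite mulrDl lerD //; first by rewrite ler_piMr.
  by rewrite ler_pdivrMr ?ltr0Sn // mul1r.
have -> : \sum_(N <= n < M) altterm s n =
   (\sum_(N <= n < M) altterm s n + d M * altterm s M) - d M * altterm s M.
  by rewrite addrK.
apply: (le_trans (normcB_le _ _)).
have : normc (d M * altterm s M) <= 1.
  by rewrite Normc.normcM mulr_ile1 ?normc_ge0 ?d1 ?normc_altterm.
by lra.
Qed.

End Alternating.

(** * Taylor expansions along a real line and the identity theorem *)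

Section Taylor.
Variable R : realType.
Implicit Types (z s : R[i]) (u v : nat -> R[i]) (x w : R).
Local Notation normc := (@Normc.normc R).
Local Notation Re := (@complex.Re R).
Local Notation Im := (@complex.Im R).

(** Convergence for the real-valued complex modulus, which avoids limits whose
    error bounds would themselves live in the complex numbers. *)
Definition ccvg u z := forall eps : R, 0 < eps ->
  exists N, forall n, (N <= n)%N -> normc (z - u n) < eps.

Lemma ccvg_of_cvg u z : u @ \oo --> (z : R[i]^o) -> ccvg u z.
Proof.
move=> /(@cvgrPdist_lt R[i] R[i]^o) h eps e0.
have e0' : 0 < eps%:C by rewrite ltcR.
have [N _ hN] := h _ e0'; exists N => n Nn.
by have := hN n Nn; rewrite /= normc_def ltcR; case: (z - u n).
Qed.

Lemma ccvg_bound u z a (b : R) N : ccvg u z ->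
  (forall n, (N <= n)%N -> normc (u n - a) <= b) -> normc (z - a) <= b.
Proof.
move=> uz hb; apply/ler_addgt0Pr => e e0.
have [M hM] := uz e e0; pose n := maxn N M.
have -> : z - a = (z - u n) + (u n - a) by rewrite addrA subrK.
apply: (le_trans (normcD_le _ _)); rewrite addrC; apply: lerD.
  by apply: hb; rewrite leq_maxl.
by apply: ltW; apply: hM; rewrite leq_maxr.
Qed.

Lemma ccvg_unique u z1 z2 : ccvg u z1 -> ccvg u z2 -> z1 = z2.
Proof.
move=> h1 h2; apply/eqP; rewrite -subr_eq0; apply/eqP/Normc.eq0_normc/eqP.
rewrite eq_le normc_ge0 andbT; apply/ler_addgt0Pr => e e0; rewrite add0r.
have [N hN] := h2 e e0.
apply: (ccvg_bound (N := N) h1) => n Nn.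
by rewrite normcB_sym ltW // hN.
Qed.

Lemma ccvg_cst z : ccvg (fun=> z) z.
Proof. by move=> e e0; exists 0%N => n _; rewrite subrr Normc.normc0. Qed.

Lemma ccvgD u v z1 z2 : ccvg u z1 -> ccvg v z2 ->
  ccvg (fun n => u n + v n) (z1 + z2).
Proof.
move=> h1 h2 e e0; have e2 : 0 < e / 2 by rewrite divr_gt0.
have [N hN] := h1 _ e2; have [M hM] := h2 _ e2; exists (maxn N M) => n.
rewrite geq_max => /andP[Nn Mn].
have -> : z1 + z2 - (u n + v n) = (z1 - u n) + (z2 - v n) by rewrite opprD addrACA.
apply: le_lt_trans (normcD_le _ _) _; rewrite [e]splitr.
by rewrite ltrD ?hN ?hM.
Qed.

Lemma ccvgM z u z1 : ccvg u z1 -> ccvg (fun n => z * u n) (z * z1).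
Proof.
move=> h e e0; have c0 : 0 < normc z + 1 by rewrite ltr_wpDl ?normc_ge0.
have [N hN] := h _ (divr_gt0 e0 c0); exists N => n Nn.
rewrite -mulrBr Normc.normcM.
have := hN n Nn; rewrite ltr_pdivlMr // => h1; apply: le_lt_trans h1.
by rewrite mulrC ler_wpM2l ?normc_ge0 // lerDl.
Qed.

Lemma ccvgB u v z1 z2 : ccvg u z1 -> ccvg v z2 ->
  ccvg (fun n => u n - v n) (z1 - z2).
Proof.
move=> h1 h2; rewrite -mulN1r.
have := ccvgD h1 (ccvgM (-1) h2).
by congr ccvg; apply/funext => n; rewrite mulN1r.
Qed.

Lemma ccvg_eq u v z : u =1 v -> ccvg u z -> ccvg v z.
Proof. by move=> /funext ->. Qed.

Lemma ccvg_sum (a : nat -> nat -> R[i]) (l : nat -> R[i]) K :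
  (forall k, ccvg (a k) (l k)) ->
  ccvg (fun n => \sum_(0 <= k < K) a k n) (\sum_(0 <= k < K) l k).
Proof.
move=> h; elim: K => [|K IH].
  by rewrite big_geq //; apply: (ccvg_eq _ (ccvg_cst 0)) => n; rewrite big_geq.
rewrite big_nat_recr //=; apply: ccvg_eq (ccvgD IH (h K)) => n.
by rewrite big_nat_recr.
Qed.

Lemma ccvg_real (u : nat -> R) (l : R) :
  u @ \oo --> l -> ccvg (fun n => (u n)%:C) l%:C.
Proof.
move=> /cvgrPdist_lt h e e0; have [N _ hN] := h _ e0; exists N => n Nn.
by rewrite -rmorphB normc_real; exact: hN.
Qed.

Lemma ccvg_ReIm u (a b : R) : (fun n => Re (u n)) @ \oo --> a ->
  (fun n => Im (u n)) @ \oo --> b -> ccvg u (a +i* b).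
Proof.
move=> /ccvg_real h1 /ccvg_real h2.
have -> : a +i* b = a%:C + 'i * b%:C.
  by apply/eqP; rewrite eq_complex /=; apply/andP; split; apply/eqP; ring.
apply: ccvg_eq (ccvgD h1 (ccvgM 'i h2)) => n; case: (u n) => c d /=.
by apply/eqP; rewrite eq_complex /=; apply/andP; split; apply/eqP; ring.
Qed.

Lemma cvg_abs_bounded (u : nat -> R) (B : R) :
  (forall M, \sum_(0 <= n < M) `|u n| <= B) -> cvgn (series u).
Proof.
move=> hB; apply: normed_cvg; apply: nondecreasing_is_cvgn.
  by apply/nondecreasing_seqP => n; rewrite /= seriesSr lerDl.
by exists B => _ [n _ <-]; exact: hB.
Qed.

Lemma ccvg_abs_bounded u (B : R) :
  (forall M, \sum_(0 <= n < M) normc (u n) <= B) ->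
  exists z, ccvg (fun M => \sum_(0 <= n < M) u n) z.
Proof.
move=> hB.
have hr : cvgn (series (fun n => Re (u n))).
  apply: (@cvg_abs_bounded _ B) => M; apply: le_trans (hB M).
  by apply: ler_sum => n _; exact: normc_Re.
have hi : cvgn (series (fun n => Im (u n))).
  apply: (@cvg_abs_bounded _ B) => M; apply: le_trans (hB M).
  by apply: ler_sum => n _; exact: normc_Im.
eexists; apply: ccvg_ReIm.
  suff -> : (fun M => Re (\sum_(0 <= n < M) u n)) = series (fun n => Re (u n)) by exact: hr.
  apply/funext => M; rewrite seriesEnat /=.
  elim: M => [|M IH]; first by rewrite !big_geq.
  by rewrite !big_nat_recr //= -IH; case: (\sum_(_ <= _ < _) _) (u M) => ? ? [].
suff -> : (fun M => Im (\sum_(0 <= n < M) u n)) = series (fun n => Im (u n)) by exact: hi.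
apply/funext => M; rewrite seriesEnat /=.
elim: M => [|M IH]; first by rewrite !big_geq.
by rewrite !big_nat_recr //= -IH; case: (\sum_(_ <= _ < _) _) (u M) => ? ? [].
Qed.

Definition tpoly (c : nat -> R[i]) K w := \sum_(0 <= k < K) c k * w%:C ^+ k.

(** Analyticity at 0 of a complex function of a real variable, in quantitative
    form: the remainders of all orders are bounded by one constant times a
    power of [|w| / rho].  Uniformity in [K] is what makes the notion stable
    under series and strong enough for the identity theorem. *)
Definition taylor (f : R -> R[i]) (c : nat -> R[i]) (rho B : R) :=
  forall K w, `|w| <= rho -> normc (f w - tpoly c K w) <= B * (`|w| / rho) ^+ K.

Lemma taylor_ge0 f c rho B : 0 < rho -> taylor f c rho B -> 0 <= B.
Proof.
move=> r0 /(_ 0%N 0); rewrite normr0 expr0 mulr1 => /(_ (ltW r0)).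
by apply: le_trans; exact: normc_ge0.
Qed.

Lemma taylor_bound f c rho B w : taylor f c rho B -> `|w| <= rho ->
  normc (f w) <= B.
Proof.
by move=> /(_ 0%N w) h /h; rewrite /tpoly big_geq // subr0 expr0 mulr1.
Qed.

Lemma taylor_shrink f c rho rho' B : 0 < rho' -> rho' <= rho ->
  taylor f c rho B -> taylor f c rho' B.
Proof.
move=> r0 rr h K w hw.
have B0 := taylor_ge0 (lt_le_trans r0 rr) h.
apply: le_trans (h K w (le_trans hw rr)) _.
have r1 := lt_le_trans r0 rr.
apply: ler_wpM2l => //; apply: lerXn2r; rewrite ?nnegrE ?divr_ge0 ?(ltW r0) ?(ltW r1) //.
by rewrite ler_wpM2l // lef_pV2 ?posrE // (lt_le_trans r0).
Qed.

Lemma taylorB f g c d rho B B' : taylor f c rho B -> taylor g d rho B' ->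
  taylor (fun w => f w - g w) (fun k => c k - d k) rho (B + B').
Proof.
move=> hf hg K w hw.
have -> : f w - g w - tpoly (fun k => c k - d k) K w =
    (f w - tpoly c K w) - (g w - tpoly d K w).
  have -> : tpoly (fun k => c k - d k) K w = tpoly c K w - tpoly d K w.
    by rewrite /tpoly -sumrB; apply: eq_bigr => k _; rewrite mulrBl.
  by rewrite !opprB addrACA [RHS]addrAC -!addrA; congr (_ + _); rewrite addrCA addrA addrC.
by apply: le_trans (normcB_le _ _) _; rewrite mulrDl lerD ?hf ?hg.
Qed.

Lemma normc_term c k w : normc (c * w%:C ^+ k) = normc c * `|w| ^+ k.
Proof. by rewrite Normc.normcM normcX normc_real. Qed.

Lemma taylor_of_abs f c rho B : 0 < rho ->
  (forall K, \sum_(0 <= k < K) normc (c k) * rho ^+ k <= B) ->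
  (forall w, `|w| <= rho -> ccvg (fun n => tpoly c n w) (f w)) ->
  taylor f c rho B.
Proof.
move=> r0 hB hf K w hw.
apply: (ccvg_bound (N := K) (hf w hw)) => M KM.
rewrite /tpoly (big_cat_nat (leq0n K) KM) //= addrAC subrr add0r.
apply: le_trans (normc_sum _ _ _) _.
set t := `|w| / rho.
have t01 : 0 <= t <= 1 by rewrite /t divr_ge0 ?(ltW r0) //= ler_pdivrMr ?mul1r.
have [t0 t1] := andP t01.
apply: le_trans (_ : \sum_(K <= k < M) t ^+ K * (normc (c k) * rho ^+ k) <= _).
  rewrite big_nat_cond [leRHS]big_nat_cond; apply: ler_sum => k.
  rewrite andbT => /andP[Kk _]; rewrite normc_term.
  have -> : `|w| = t * rho by rewrite divfK ?gt_eqF.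
  rewrite exprMn mulrCA ler_wpM2r ?mulr_ge0 ?normc_ge0 ?exprn_ge0 ?(ltW r0) //.
  exact: ler_wiXn2l.
rewrite -mulr_sumr mulrC; apply: ler_wpM2r; first exact: exprn_ge0.
apply: le_trans (hB M); rewrite [leRHS](big_cat_nat (leq0n K) KM) //= lerDr.
by apply: sumr_ge0 => k _; rewrite mulr_ge0 ?normc_ge0 ?exprn_ge0 ?(ltW r0).
Qed.

Lemma le0_of_geometric (x B t : R) : 0 <= t -> t < 1 ->
  (forall K, x <= B * t ^+ K) -> x <= 0.
Proof.
move=> t0 t1 h.
have c : (fun K => B * t ^+ K) @ \oo --> B * 0.
  by apply: cvgMr; apply: cvg_expr; rewrite ger0_norm.
rewrite mulr0 in c; rewrite -(cvg_lim _ c) //.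
by apply: limr_ge; [exact: cvgP c | near=> K; exact: h].
Unshelve. all: by end_near. Qed.

(** Identity theorem.  If [f] vanishes on a right neighbourhood of 0, its
    coefficients vanish one after the other, by letting [w] tend to 0 in the
    remainder of order [k + 1]; the remainders then show that [f] is smaller
    than every [B (|w| / rho)^K]. *)
Lemma taylor_eq0 f c rho B e : 0 < rho -> taylor f c rho B -> 0 < e ->
  (forall w, 0 < w -> w < e -> f w = 0) -> forall w, `|w| < rho -> f w = 0.
Proof.
move=> r0 hf e0 hz.
have B0 := taylor_ge0 r0 hf.
have c0 : forall k, c k = 0.
  elim/ltn_ind => k IH.
  apply/Normc.eq0_normc/eqP; rewrite eq_le normc_ge0 andbT.
  apply/ler_addgt0Pr => d d0; rewrite add0r.
  (* [w] is so small that the remainder of order [k + 1] is at most [d w^k]. *)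
  pose D := B / rho ^+ k.+1 + 1.
  have D0 : 0 < D by rewrite ltr_wpDl // divr_ge0 ?exprn_ge0 ?(ltW r0).
  pose w := Num.min (Num.min (e / 2) rho) (d / D).
  have w0 : 0 < w by rewrite !lt_min r0 !divr_gt0.
  have we : w < e.
    by apply: le_lt_trans (_ : e / 2 < e); rewrite ?ge_min ?lexx //; lra.
  have wr : w <= rho by rewrite !ge_min lexx orbT.
  have wd : w <= d / D by rewrite ge_min lexx orbT.
  have := hf k.+1 w; rewrite (gtr0_norm w0) => /(_ wr).
  rewrite (hz w w0 we) sub0r normcN_eq /tpoly big_nat_recr //= big_nat big1.
    rewrite add0r normc_term (gtr0_norm w0).
    have wk : 0 < w ^+ k by rewrite exprn_gt0.
    have -> : B * (w / rho) ^+ k.+1 = B / rho ^+ k.+1 * w * w ^+ k.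
      by rewrite expr_div_n [w ^+ k.+1]exprS; ring.
    rewrite (ler_pM2r wk) => h.
    apply: le_trans h _; apply: le_trans (_ : D * w <= _).
      by rewrite ler_wpM2r ?(ltW w0) // lerDl.
    by move: wd; rewrite ler_pdivlMr // mulrC.
  by move=> j /andP[_ /IH ->]; rewrite mul0r.
move=> w wr; apply/Normc.eq0_normc/eqP; rewrite eq_le normc_ge0 andbT.
apply: (@le0_of_geometric _ B (`|w| / rho)).
- by rewrite divr_ge0 ?(ltW r0).
- by rewrite ltr_pdivrMr ?mul1r.
move=> K; have := hf K w (ltW wr).
rewrite /tpoly big1 ?subr0 // => k _; by rewrite c0 mul0r.
Qed.

Definition conv (a b : nat -> R[i]) m := \sum_(0 <= i < m.+1) a i * b (m - i)%N.

Lemma tpoly_conv a b K w : tpoly (conv a b) K w =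
  \sum_(0 <= i < K) a i * w%:C ^+ i * tpoly b (K - i) w.
Proof.
elim: K => [|K IH]; first by rewrite /tpoly !big_geq.
rewrite {1}/tpoly big_nat_recr //= -/(tpoly _ _ _) IH /conv.
rewrite [in LHS]big_nat_recr //= [in RHS]big_nat_recr //= subnn subSnn.
rewrite mulrDl addrA mulr_suml -big_split /=; congr (_ + _).
  rewrite big_nat [RHS]big_nat; apply: eq_bigr => i /andP[_ iK].
  rewrite subSn ?(ltnW iK) // {2}/tpoly big_nat_recr //= -/(tpoly _ _ _).
  rewrite mulrDr; congr (_ + _).
  have -> : w%:C ^+ K = w%:C ^+ i * w%:C ^+ (K - i).
    by rewrite -exprD subnKC // ltnW.
  by rewrite mulrACA.
by rewrite /tpoly big_nat1 expr0 mulr1 mulrAC.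
Qed.

(** The Cauchy product truncated at order [K] differs from the product by
    [(e - e_K) f + \sum_(i < K) a_i w^i (f - f_(K-i))], and every summand is
    already of order [|w|^K]. *)
Lemma taylorM e f a b rho A B : 0 < rho ->
  (forall K, \sum_(0 <= k < K) normc (a k) * rho ^+ k <= A) ->
  taylor e a rho A -> taylor f b rho B ->
  taylor (fun w => e w * f w) (conv a b) rho (2 * (A * B)).
Proof.
move=> r0 hA he hf K w hw.
have A0 := taylor_ge0 r0 he; have B0 := taylor_ge0 r0 hf.
set t := `|w| / rho; have t0 : 0 <= t by rewrite divr_ge0 ?(ltW r0).
have -> : e w * f w - tpoly (conv a b) K w = (e w - tpoly a K w) * f w +
    \sum_(0 <= i < K) a i * w%:C ^+ i * (f w - tpoly b (K - i) w).
  rewrite tpoly_conv.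
  under [X in _ = _ + X]eq_bigr do rewrite mulrBr.
  by rewrite sumrB -mulr_suml -/(tpoly a K w) mulrBl addrA subrK.
apply: le_trans (normcD_le _ _) _.
have -> : 2 * (A * B) * t ^+ K = A * t ^+ K * B + A * (B * t ^+ K) by ring.
apply: lerD.
  rewrite Normc.normcM; apply: ler_pM; rewrite ?normc_ge0 //; first exact: he.
  exact: taylor_bound hf hw.
apply: le_trans (normc_sum _ _ _) _.
apply: le_trans (_ : \sum_(0 <= i < K) normc (a i) * rho ^+ i * (B * t ^+ K) <= _).
  rewrite big_nat [leRHS]big_nat; apply: ler_sum => i /andP[_ iK].
  rewrite Normc.normcM normc_term -mulrA -[leRHS]mulrA ler_wpM2l ?normc_ge0 //.
  have -> : rho ^+ i * (B * t ^+ K) = `|w| ^+ i * (B * t ^+ (K - i)).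
    have -> : t ^+ K = t ^+ i * t ^+ (K - i).
      by rewrite -exprD subnKC // ltnW.
    have -> : `|w| ^+ i = t ^+ i * rho ^+ i by rewrite -exprMn divfK ?gt_eqF.
    by move: (t ^+ i) (t ^+ (K - i)) (rho ^+ i) => p q r; ring.
  by rewrite ler_wpM2l ?exprn_ge0 ?normr_ge0 ?hf.
by rewrite -mulr_suml ler_wpM2r ?mulr_ge0 ?exprn_ge0.
Qed.

(** Termwise Taylor expansion of a series: the coefficients are the sums of the
    coefficients, and the remainder bounds add up for each [K]. *)
Lemma taylor_series (e : nat -> R -> R[i]) (a : nat -> nat -> R[i])
    (b : nat -> R) g rho B : 0 < rho ->
  (forall n K, \sum_(0 <= k < K) normc (a n k) * rho ^+ k <= b n) ->
  (forall n, taylor (e n) (a n) rho (b n)) ->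
  (forall M, \sum_(0 <= n < M) b n <= B) ->
  (forall w, `|w| <= rho -> ccvg (fun M => \sum_(0 <= n < M) e n w) (g w)) ->
  exists c, taylor g c rho B.
Proof.
move=> r0 ha he hB hg.
have ank n k : normc (a n k) <= b n / rho ^+ k.
  rewrite ler_pdivlMr ?exprn_gt0 //; apply: le_trans (ha n k.+1).
  rewrite big_nat_recr //= lerDr; apply: sumr_ge0 => j _.
  by rewrite mulr_ge0 ?normc_ge0 ?exprn_ge0 ?(ltW r0).
have hc k : exists z, ccvg (fun M => \sum_(0 <= n < M) a n k) z.
  apply: (@ccvg_abs_bounded _ (B / rho ^+ k)) => M.
  apply: le_trans (ler_sum _ (fun n _ => ank n k)) _.
  by rewrite -mulr_suml ler_wpM2r ?invr_ge0 ?exprn_ge0 ?(ltW r0).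
have [c cP] := choice hc; exists c => K w hw.
have h1 : ccvg (fun M => \sum_(0 <= n < M) e n w -
    \sum_(0 <= k < K) w%:C ^+ k * \sum_(0 <= n < M) a n k)
    (g w - \sum_(0 <= k < K) w%:C ^+ k * c k).
  apply: ccvgB; first exact: hg.
  by apply: ccvg_sum => k; apply: ccvgM.
have -> : g w - tpoly c K w = g w - \sum_(0 <= k < K) w%:C ^+ k * c k - 0.
  by rewrite subr0 /tpoly; congr (_ - _); apply: eq_bigr => k _; rewrite mulrC.
apply: (ccvg_bound (N := 0%N) h1) => M _; rewrite subr0.
have -> : \sum_(0 <= k < K) w%:C ^+ k * \sum_(0 <= n < M) a n k =
    \sum_(0 <= n < M) tpoly (a n) K w.
  under eq_bigr do rewrite mulr_sumr.
  rewrite exchange_big /=; apply: eq_bigr => n _.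
  by apply: eq_bigr => k _; rewrite mulrC.
rewrite -sumrB; apply: le_trans (normc_sum _ _ _) _.
apply: le_trans (ler_sum _ (fun n _ => he n K w hw)) _.
by rewrite -mulr_suml ler_wpM2r ?exprn_ge0 ?divr_ge0 ?(ltW r0).
Qed.

End Taylor.

(** * The alternating series and the continuation of zeta *)

Section Eta.
Variable R : realType.
Implicit Types (z s : R[i]) (x w : R) (zeta : R[i] -> R[i]).
Local Notation normc := (@Normc.normc R).
Local Notation Re := (@complex.Re R).
Local Notation Im := (@complex.Im R).

Lemma cvg_exp_series x :
  (fun n => \sum_(0 <= k < n) (x ^+ k / k`!%:R)) @ \oo --> expR x.
Proof. exact: (@is_cvg_series_exp_coeff R x). Qed.

Lemma exp_partial_sub_le x y K : 0 <= x -> x <= y ->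
  \sum_(0 <= k < K) (y ^+ k / k`!%:R - x ^+ k / k`!%:R) <= expR y - expR x.
Proof.
move=> x0 xy.
have c : (fun n => \sum_(0 <= k < n) (y ^+ k / k`!%:R - x ^+ k / k`!%:R))
    @ \oo --> expR y - expR x.
  under eq_fun do rewrite sumrB.
  by apply: cvgB; exact: cvg_exp_series.
rewrite -(cvg_lim _ c) //.
apply: (nondecreasing_cvgn_le (u_ := fun n =>
  \sum_(0 <= k < n) (y ^+ k / k`!%:R - x ^+ k / k`!%:R))); last exact: cvgP c.
apply/nondecreasing_seqP => n; rewrite big_nat_recr //= lerDl subr_ge0.
by rewrite ler_wpM2r ?invr_ge0 // lerXn2r ?nnegrE // (le_trans x0).
Qed.

Lemma exp_partial_le x K : 0 <= x ->
  \sum_(0 <= k < K) (x ^+ k / k`!%:R) <= expR x.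
Proof.
move=> x0; rewrite -(cvg_lim _ (@cvg_exp_series x)) //.
apply: (nondecreasing_cvgn_le (u_ := fun n => \sum_(0 <= k < n) (x ^+ k / k`!%:R))).
  apply/nondecreasing_seqP => n; rewrite big_nat_recr //= lerDl.
  by rewrite mulr_ge0 ?exprn_ge0 ?invr_ge0.
exact: cvgP (@cvg_exp_series x).
Qed.

(** Taylor coefficients at [w = 0] of [exp (- (s + w) L)]; with [L = log n] this is
    [n^(- (s + w))]. *)
Definition expcoef s (L : R) k : R[i] :=
  cexp (- s * L%:C) * ((- L) ^+ k / k`!%:R)%:C.

Lemma ccvg_expcoef s L w :
  ccvg (fun n => tpoly (expcoef s L) n w) (cexp (- (s + w%:C) * L%:C)).
Proof.
have -> : cexp (- (s + w%:C) * L%:C) = cexp (- s * L%:C) * (expR (- L * w))%:C.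
  have -> : - (s + w%:C) * L%:C = - s * L%:C + (- L * w)%:C.
    by rewrite rmorphM rmorphN; ring.
  by rewrite cexpD; congr (_ * _); rewrite /cexp /= cos0 sin0 mulr1 mulr0.
apply: ccvg_eq (ccvgM _ (ccvg_real (@cvg_exp_series (- L * w)))) => n.
rewrite /tpoly rmorph_sum mulr_sumr; apply: eq_bigr => k _.
rewrite /expcoef -mulrA -rmorphXn -rmorphM; congr (_ * _%:C).
by rewrite exprMn mulrAC.
Qed.

Lemma normc_expcoef s L k : 0 <= L ->
  normc (expcoef s L k) = normc (cexp (- s * L%:C)) * (L ^+ k / k`!%:R).
Proof.
move=> L0; rewrite /expcoef Normc.normcM normc_real; congr (_ * _).
by rewrite normrM normfV normrX normrN !ger0_norm.
Qed.

Lemma sum_expcoef s L rho K : 0 <= L -> 0 <= rho ->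
  \sum_(0 <= k < K) normc (expcoef s L k) * rho ^+ k
    <= normc (cexp (- s * L%:C)) * expR (L * rho).
Proof.
move=> L0 r0; apply: le_trans (_ : normc (cexp (- s * L%:C)) *
   \sum_(0 <= k < K) ((L * rho) ^+ k / k`!%:R) <= _).
  rewrite mulr_sumr le_eqVlt; apply/orP; left; apply/eqP.
  apply: eq_bigr => k _; rewrite normc_expcoef // -mulrA; congr (_ * _).
  by rewrite exprMn mulrAC.
by rewrite ler_wpM2l ?normc_ge0 // exp_partial_le // mulr_ge0.
Qed.

Definition pairterm s n : R[i] := nat_cpowN n.*2.+1 s - nat_cpowN n.*2.+2 s.

Definition paircoef s n k : R[i] :=
  expcoef s (lnS R n.*2) k - expcoef s (lnS R n.*2.+1) k.

Lemma ccvg_paircoef s n w :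
  ccvg (fun m => tpoly (paircoef s n) m w) (pairterm (s + w%:C) n).
Proof.
apply: ccvg_eq (ccvgB (ccvg_expcoef s (lnS R n.*2) w)
                      (ccvg_expcoef s (lnS R n.*2.+1) w)) => m.
by rewrite /tpoly -sumrB; apply: eq_bigr => k _; rewrite -mulrBl.
Qed.

(** Bound for the Taylor coefficients of [pairterm], weighted by powers of
    [rho].  It retains the cancellation inside the pair: from
    [P a - Q b = (P - Q) a + Q (a - b)], where [a] and [b] are coefficients of
    exponential series with the arguments [rho L], up to sign. *)
Definition pairbd s n (rho : R) : R :=
  let P := cexp (- s * (lnS R n.*2)%:C) in
  let Q := cexp (- s * (lnS R n.*2.+1)%:C) in
  normc (P - Q) * expR (lnS R n.*2 * rho) +
  normc Q * (expR (lnS R n.*2.+1 * rho) - expR (lnS R n.*2 * rho)).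

Lemma lnS_le m n : (m <= n)%N -> lnS R m <= lnS R n.
Proof.
rewrite leq_eqVlt => /orP[/eqP -> //|h].
exact/ltW/lnS_inj_lt.
Qed.

Lemma sum_paircoef s n rho K : 0 <= rho ->
  \sum_(0 <= k < K) normc (paircoef s n k) * rho ^+ k <= pairbd s n rho.
Proof.
move=> r0; rewrite /pairbd.
set P := cexp _; set Q := cexp _.
have := lnS_ge0 R n.*2; have := lnS_le (leqnSn n.*2).
rewrite /paircoef /expcoef -/P -/Q.
move: P Q (lnS R n.*2) (lnS R n.*2.+1) => P Q p q pq p0.
have pq' : p * rho <= q * rho by rewrite ler_wpM2r.
have pr0 : 0 <= p * rho by rewrite mulr_ge0.
apply: le_trans (_ : normc (P - Q) * \sum_(0 <= k < K) ((p * rho) ^+ k / k`!%:R)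
  + normc Q * \sum_(0 <= k < K) ((q * rho) ^+ k / k`!%:R - (p * rho) ^+ k / k`!%:R)
  <= _); last first.
  by rewrite lerD // ler_wpM2l ?normc_ge0 // (exp_partial_le, exp_partial_sub_le).
rewrite !mulr_sumr -big_split; apply: ler_sum => k _.
have -> : P * ((- p) ^+ k / k`!%:R)%:C - Q * ((- q) ^+ k / k`!%:R)%:C =
   (P - Q) * ((- p) ^+ k / k`!%:R)%:C +
   Q * ((- p) ^+ k / k`!%:R - (- q) ^+ k / k`!%:R)%:C.
  by rewrite rmorphB; ring.
apply: le_trans (_ : (normc (P - Q) * (p ^+ k / k`!%:R) +
   normc Q * (q ^+ k / k`!%:R - p ^+ k / k`!%:R)) * rho ^+ k <= _).
  rewrite ler_wpM2r ?exprn_ge0 //; apply: le_trans (normcD_le _ _) _.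
  rewrite !Normc.normcM !normc_real lerD // ler_wpM2l ?normc_ge0 //.
    by rewrite normrM normfV normrX normrN !ger0_norm.
  rewrite -!mulrBl normrM normfV [`|k`!%:R|]ger0_norm //.
  rewrite ler_wpM2r ?invr_ge0 // [(- p) ^+ k]exprNn [(- q) ^+ k]exprNn -mulrBr normrM normrX normrN1 expr1n mul1r.
  by rewrite distrC ger0_norm // subr_ge0 lerXn2r ?nnegrE // (le_trans p0).
rewrite !exprMn; set a := rho ^+ k; set b := p ^+ k; set c := q ^+ k.
by set d := (k`!%:R)^-1; rewrite -[leRHS]/(_ + _) le_eqVlt; apply/orP; left; apply/eqP; ring.
Qed.

(** [(m + 1)^(-1/4)] *)
Definition decay m : R := expR (- (lnS R m / 4)).

Lemma decay_le m n : (m <= n)%N -> decay n <= decay m.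
Proof. by move=> mn; rewrite ler_expR lerN2 ler_wpM2r ?lnS_le. Qed.

(** With [d] the logarithmic gap inside the pair, both terms of [pairbd] are
    [O(d (2n+1)^(-1/4))], the exponent being [rho - Re s <= 1/4 - 1/2].  This is
    comparable to a difference of two values of [decay], and such differences
    are summable by telescoping. *)
Lemma pairbd_le s n : 1 / 2 <= Re s ->
  pairbd s n (1 / 4) <= 4 * expR 1 * (2 * (Re s + `|Im s|) + 1) *
    (decay n.*2 - decay n.*2.+2).
Proof.
move=> s2; have s0 : 0 <= Re s by lra.
have := decay_le (leqnSn n.*2.+1).
rewrite /pairbd /decay -[lnS R n.*2.+1](subrKC (lnS R n.*2)) -/(lngap R _).
have /andP[_ d1'] := lngap_bounds R n.*2.
have d1 : lngap R n.*2 <= 1.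
  by apply: le_trans d1' _; rewrite invf_le1 ?ltr0Sn ?ler1n.
have d0 := lngap_ge0 R n.*2; have p0 := lnS_ge0 R n.*2.
move: (lnS R n.*2) (lngap R n.*2) (lnS R n.*2.+2) d0 d1 p0 {d1'} => p d r d0 d1 p0.
set vp := expR (- (p / 4)); set vq := expR (- ((p + d) / 4)).
set vr := expR _ => vrq.
set K := 2 * (Re s + `|Im s|).
have K0 : 0 <= K by rewrite mulr_ge0 ?addr_ge0.
have vp0 : 0 <= vp by exact: expR_ge0.
have vq0 : 0 <= vq by exact: expR_ge0.
have vqp : vq <= vp by rewrite ler_expR; lra.
have T1 : normc (cexp (- s * p%:C) - cexp (- s * (p + d)%:C)) * expR (p * (1 / 4))
    <= vp * (K * d).
  have -> : cexp (- s * (p + d)%:C) = cexp (- s * p%:C) * cexp (- s * d%:C).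
    by rewrite rmorphD mulrDr cexpD.
  rewrite -[X in X - _]mulr1 -mulrBr Normc.normcM normcB_sym.
  rewrite normc_cexp ReM_real ReN_eq mulrAC -expRD ler_pM ?expR_ge0 ?normc_ge0 //.
    by rewrite ler_expR; nra.
  exact: cexp_sub1_real.
have T2 : normc (cexp (- s * (p + d)%:C)) *
   (expR ((p + d) * (1 / 4)) - expR (p * (1 / 4))) <= vp * d.
  apply: le_trans (_ : vq * (d / 4) <= _); last first.
    by rewrite ler_pM ?divr_ge0 //; lra.
  apply: le_trans (_ : normc (cexp (- s * (p + d)%:C)) *
     (d / 4 * expR ((p + d) * (1 / 4))) <= _).
    rewrite ler_wpM2l ?normc_ge0 //; apply: le_trans (expR_sub_le _ _) _.
    by rewrite ler_wpM2r ?expR_ge0 //; lra.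
  rewrite mulrCA mulrC ler_wpM2r ?divr_ge0 //.
  rewrite normc_cexp ReM_real ReN_eq -expRD ler_expR.
  have : 0 <= p + d by rewrite addr_ge0.
  move: (p + d) => q q0; nra.
have vpq : vp <= expR 1 * vq by rewrite -expRD ler_expR; lra.
have gap : d / 4 * vq <= vp - vq.
  have -> : vp = expR (d / 4) * vq by rewrite -expRD; congr expR; ring.
  have := expR_ge1Dx (d / 4) => h.
  by rewrite -subr_ge0 -[X in _ - X - _]mul1r -!mulrBl mulr_ge0 //; lra.
apply: le_trans (lerD T1 T2) _.
have -> : vp * (K * d) + vp * d = (K + 1) * (vp * d) by ring.
rewrite [leRHS](_ : _ = (K + 1) * (4 * expR 1 * (vp - vr))); last by ring.
rewrite ler_wpM2l ?addr_ge0 //.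
apply: le_trans (_ : expR 1 * vq * d <= _); first by rewrite ler_wpM2r.
have -> : expR 1 * vq * d = 4 * expR 1 * (d / 4 * vq) by field.
by rewrite ler_wpM2l ?mulr_ge0 ?expR_ge0 //; lra.
Qed.

(** The radius 1/4 keeps the pairs summable when [Re s >= 1/2]: it leaves an
    abscissa of at least 1/4. *)
Lemma eta_taylor s : 1 / 2 <= Re s -> exists (g : R -> R[i]) c B,
  (forall w, `|w| <= 1 / 4 ->
     ccvg (fun M => \sum_(0 <= n < M) pairterm (s + w%:C) n) (g w)) /\
  taylor g c (1 / 4) B.
Proof.
move=> s2; have r0 : 0 < 1 / 4 :> R by lra.
have he n : taylor (fun w => pairterm (s + w%:C) n) (paircoef s n) (1 / 4)
    (pairbd s n (1 / 4)).
  apply: taylor_of_abs => // [K|w _]; last exact: ccvg_paircoef.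
  by apply: sum_paircoef; rewrite ltW.
pose B := 4 * expR 1 * (2 * (Re s + `|Im s|) + 1).
have B0 : 0 <= B.
  have := normr_ge0 (Im s) => h.
  by rewrite /B !mulr_ge0 ?expR_ge0 //; lra.
have hB M : \sum_(0 <= n < M) pairbd s n (1 / 4) <= B.
  apply: le_trans (_ : B * \sum_(0 <= n < M) (decay n.*2 - decay n.*2.+2) <= _).
    by rewrite mulr_sumr; apply: ler_sum => n _; exact: pairbd_le.
  have -> : \sum_(0 <= n < M) (decay n.*2 - decay n.*2.+2) = decay 0 - decay M.*2.
    elim: M => [|M IH]; first by rewrite big_geq // subrr.
    by rewrite big_nat_recr //= IH doubleS addrA subrK.
  rewrite -[leRHS]mulr1 ler_wpM2l //.
  have : 0 <= decay M.*2 by exact: expR_ge0.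
  by rewrite /decay /lnS ln1 mul0r oppr0 expR0; lra.
have hg w : exists z, `|w| <= 1 / 4 ->
    ccvg (fun M => \sum_(0 <= n < M) pairterm (s + w%:C) n) z.
  have [hw|] := boolP (`|w| <= 1 / 4); last by exists 0.
  have [z hz] : exists z, ccvg (fun M => \sum_(0 <= n < M) pairterm (s + w%:C) n) z.
    apply: (@ccvg_abs_bounded _ _ B) => M; apply: le_trans (hB M).
    by apply: ler_sum => n _; apply: taylor_bound (he n) hw.
  by exists z.
have [g gP] := choice hg.
have [c hc] := taylor_series r0 (fun n K => sum_paircoef s n K (ltW r0)) he hB gP.
by exists g, c, B.
Qed.

(** The terms of the power series are bounded at half the radius of convergence,
    hence dominated by a geometric series at a quarter of it. *)
Lemma analytic_taylor zeta s : analytic_at zeta s -> exists c rho B,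
  0 < rho /\ taylor (fun w => zeta (s + w%:C)) c rho B.
Proof.
move=> [r r0 [a aP]].
have cP w : `|w| < r -> ccvg (fun n => tpoly a n w) (zeta (s + w%:C)).
  move=> wr; have e : s + w%:C - s = w%:C by rewrite addrAC subrr add0r.
  have := aP (s + w%:C); rewrite e normc_real => /(_ wr) /ccvg_of_cvg.
  exact.
have r2 : 0 < r / 2 by lra.
have [N hN] : exists N, forall k, (N <= k)%N -> normc (a k) * (r / 2) ^+ k <= 2.
  have h2 : `|r / 2| < r by rewrite gtr0_norm //; lra.
  have [N hN] := cP _ h2 1 ltr01; exists N => k Nk.
  have := hN _ Nk; have := hN _ (leqW Nk).
  rewrite /tpoly big_nat_recr //= -/(tpoly _ _ _) => h3 h4.
  rewrite -[r / 2 in X in X <= _](gtr0_norm r2) -normc_term.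
  move: h3 h4; set T := a k * _; move: (tpoly _ _ _) (zeta _) => S Z h3 h4.
  have -> : T = (Z - S) - (Z - (S + T)) by ring.
  by apply: le_trans (normcB_le _ _) _; lra.
pose B := 2 + \sum_(0 <= k < N) normc (a k) * (r / 2) ^+ k.
have Tk k : 0 <= normc (a k) * (r / 2) ^+ k.
  by rewrite mulr_ge0 ?normc_ge0 ?exprn_ge0 ?(ltW r2).
have hB k : normc (a k) * (r / 2) ^+ k <= B.
  have [/hN h|kN] := leqP N k.
    by apply: le_trans h _; rewrite lerDl sumr_ge0.
  apply: le_trans (_ : 0 + \sum_(0 <= j < N) normc (a j) * (r / 2) ^+ j <= _).
    rewrite add0r (big_cat_nat (leq0n k.+1) kN) //= big_nat_recr //=.
    by rewrite -[leLHS]add0r -addrA lerD ?sumr_ge0 // lerDl sumr_ge0.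
  by rewrite lerD.
have r4 : 0 < r / 4 by lra.
exists a, (r / 4), (2 * B); split => //; apply: taylor_of_abs => //; last first.
  by move=> w hw; apply: cP; apply: le_lt_trans hw _; lra.
move=> K; apply: le_trans (_ : \sum_(0 <= k < K) B * (1 / 2) ^+ k <= _).
  apply: ler_sum => k _; rewrite (_ : r / 4 = r / 2 * (1 / 2)); last by field.
  by rewrite exprMn mulrA ler_wpM2r ?exprn_ge0 //; lra.
have B0 : 0 <= B by exact: le_trans (Tk 0%N) (hB 0%N).
have -> : \sum_(0 <= k < K) B * (1 / 2) ^+ k = 2 * B - 2 * B * (1 / 2) ^+ K.
  elim: K => [|K IH]; first by rewrite big_geq // expr0 mulr1 subrr.
  by rewrite big_nat_recr //= IH exprS; field.
by rewrite lerBlDr lerDl !mulr_ge0 ?exprn_ge0 //; lra.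
Qed.

(** [(1 - 2^(1-s)) zeta(s)] *)
Definition etaz zeta s : R[i] :=
  zeta s - cexp (- (s - 1) * (ln 2)%:C) * zeta s.

Lemma cexp_ln2 s : cexp (- (s - 1) * (ln 2)%:C) = 2 * nat_cpowN 2 s.
Proof.
rewrite /nat_cpowN.
have -> : - (s - 1) * (ln 2)%:C = (ln 2)%:C + - s * (ln (2%:R : R))%:C by ring.
rewrite cexpD; congr (_ * _); rewrite /cexp /= cos0 sin0 mulr1 mulr0 lnK ?posrE //.
by rewrite -[LHS]/((2%:R : R)%:C) rmorph_nat.
Qed.

(** The even integers up to [2M] are the doubles of the integers up to [M]. *)
Lemma sum_pairterm s M : \sum_(0 <= n < M) pairterm s n =
  \sum_(0 <= n < M.*2) nat_cpowN n.+1 s -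
  cexp (- (s - 1) * (ln 2)%:C) * \sum_(0 <= n < M) nat_cpowN n.+1 s.
Proof.
elim: M => [|M IH]; first by rewrite !big_geq // mulr0 subrr.
rewrite big_nat_recr //= IH doubleS big_nat_recr //= big_nat_recr //=.
rewrite [in RHS]big_nat_recr //= /pairterm.
have -> : nat_cpowN M.*2.+2 s = nat_cpowN 2 s * nat_cpowN M.+1 s.
  rewrite /nat_cpowN -cexpD -mulrDr -rmorphD -lnM ?posrE ?ltr0Sn // -natrM.
  by rewrite mul2n doubleS.
rewrite cexp_ln2; ring.
Qed.

Lemma sum_pairterm_alt s M :
  \sum_(0 <= n < M) pairterm s n = \sum_(0 <= n < M.*2) altterm s n.
Proof.
elim: M => [|M IH]; first by rewrite !big_geq.
rewrite big_nat_recr //= IH doubleS big_nat_recr //= big_nat_recr //=.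
have e : (-1) ^+ M.*2 = 1 :> R[i] by rewrite -signr_odd odd_double.
by rewrite /altterm /pairterm exprS e mulr1 mulN1r mul1r addrA.
Qed.

Lemma etaz_half_plane zeta s : is_riemann_zeta zeta -> 1 < Re s ->
  ccvg (fun M => \sum_(0 <= n < M) pairterm s n) (etaz zeta s).
Proof.
move=> [zP _] s1; have := ccvg_of_cvg (zP s s1); rewrite /series /= => h.
have h2 : ccvg (fun M => \sum_(0 <= n < M.*2) nat_cpowN n.+1 s) (zeta s).
  move=> e e0; have [N hN] := h e e0; exists N => n Nn; apply: hN.
  by apply: leq_trans Nn _; rewrite -addnn leq_addr.
apply: ccvg_eq (ccvgB h2 (ccvgM (cexp (- (s - 1) * (ln 2)%:C)) h)) => M.
by rewrite sum_pairterm.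
Qed.

Definition etaz_at zeta (u x : R) :=
  ccvg (fun M => \sum_(0 <= n < M) pairterm (x +i* u) n) (etaz zeta (x +i* u)).

(** On a line that avoids the pole, both sides of the identity are analytic at
    [x]; they agree to the right of [x], hence on a neighbourhood of [x]. *)
Lemma etaz_at_step zeta u x e : is_riemann_zeta zeta -> u != 0 ->
  1 / 2 <= x -> 0 < e -> (forall y, x < y -> y < x + e -> etaz_at zeta u y) ->
  exists2 r, 0 < r & forall y, `|y - x| < r -> etaz_at zeta u y.
Proof.
move=> [_ zA] u0 x2 e0 hx; set s := x +i* u.
have sD (w : R) : s + w%:C = (x + w) +i* u.
  by apply/eqP; rewrite /s eq_complex /= addr0 !eqxx.
have s1 : s != 1 by rewrite /s eq_complex /= negb_and u0 orbT.
have [cz [rz [Bz [rz0 hz]]]] := analytic_taylor (zA s s1).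
have [g [cg [Bg [gP hg]]]] := @eta_taylor s x2.
pose r := Num.min rz (1 / 4).
have r0 : 0 < r by rewrite lt_min rz0 /=; lra.
have rrz : r <= rz by rewrite ge_min lexx.
have r14 : r <= 1 / 4 by rewrite ge_min lexx orbT.
have hz' := taylor_shrink r0 rrz hz; have hg' := taylor_shrink r0 r14 hg.
have l2 : 0 <= ln 2 :> R by rewrite ln_ge0 // ler1n.
have hE : taylor (fun w => cexp (- (s - 1 + w%:C) * (ln 2)%:C))
    (expcoef (s - 1) (ln 2)) r
    (normc (cexp (- (s - 1) * (ln 2)%:C)) * expR (ln 2 * r)).
  apply: taylor_of_abs => // [K|w _]; last exact: ccvg_expcoef.
  by apply: sum_expcoef; rewrite // ltW.
have hEz := taylorM r0 (fun K => sum_expcoef (s - 1) K l2 (ltW r0)) hE hz'.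
have hD := taylorB (taylorB hz' hEz) hg'.
have Fg w : etaz zeta (s + w%:C) - g w = zeta (s + w%:C) -
   cexp (- (s - 1 + w%:C) * (ln 2)%:C) * zeta (s + w%:C) - g w.
  by rewrite /etaz [s - 1 + _]addrAC.
have z0 w : 0 < w -> w < Num.min e r -> etaz zeta (s + w%:C) - g w = 0.
  rewrite lt_min => w0 /andP[we wr]; apply/eqP; rewrite subr_eq0; apply/eqP.
  have q : etaz_at zeta u (x + w) by apply: hx; lra.
  rewrite /etaz_at -sD in q; apply: (ccvg_unique q); apply: gP.
  by rewrite gtr0_norm //; lra.
exists r => // y yr.
have : etaz zeta (s + (y - x)%:C) - g (y - x) = 0.
  rewrite Fg; apply: (taylor_eq0 (e := Num.min e r) r0 hD _ _ yr) => [|w w0 we].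
    by rewrite lt_min e0 r0.
  by rewrite -Fg; apply: z0.
move=> /eqP; rewrite subr_eq0 => /eqP eg.
rewrite /etaz_at -[y](subrKC x) -sD eg; apply: gP.
by apply/ltW/(lt_le_trans yr).
Qed.

(** Let [m] be the infimum of the abscissae at least 1/2 to the right of which
    the identity holds; by [etaz_at_step] it holds around [m], so [m > 1/2]
    would contradict minimality. *)
Lemma etaz_half zeta u : is_riemann_zeta zeta -> u != 0 ->
  ccvg (fun M => \sum_(0 <= n < M) pairterm (2^-1 +i* u) n)
    (etaz zeta (2^-1 +i* u)).
Proof.
move=> zP u0.
pose S : set R := [set x | 1 / 2 <= x /\ forall y, x < y -> etaz_at zeta u y].
have S1 : S 1 by split=> [|y y1]; [lra | exact: etaz_half_plane].
have lbS : lbound S (1 / 2) by move=> x [].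
have hiS : has_inf S by split; [exists 1 | exists (1 / 2)].
set m := inf S.
have m2 : 1 / 2 <= m by apply: lb_le_inf => //; exists 1.
have above y : m < y -> etaz_at zeta u y.
  by move=> my; have [x [_ Sx] xy] := inf_lt (proj1 hiS) my; exact: Sx.
have [r r0 hr] := @etaz_at_step zeta u m 1 zP u0 m2 ltr01 (fun y h _ => above y h).
suff -> : 2^-1 = m by apply: hr; rewrite subrr normr0.
apply/eqP; rewrite eq_le -div1r m2 /= leNgt; apply/negP => lt2.
pose x1 := Num.max (1 / 2) (m - r / 2).
have x1m : x1 < m by rewrite gt_max lt2 /=; lra.
have : S x1.
  split=> [|y]; first by rewrite le_max lexx.
  rewrite gt_max => /andP[_ yr]; have [my|ym] := ltP m y; first exact: above.
  by apply: hr; rewrite ltr_norml; lra.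
by move=> /(inf_lbound (proj2 hiS)); rewrite leNgt x1m.
Qed.

End Eta.

(** * From the mean square to large values of zeta *)

Section LargeValues.
Variable R : realType.
Implicit Types (zeta : R[i] -> R[i]) (u x y T : R).
Local Notation normc := (@Normc.normc R).
Local Notation Re := (@complex.Re R).
Local Notation Im := (@complex.Im R).

(** Coefficients of the alternating Dirichlet polynomial at [Re s = 1/2]. *)
Definition altcoef n : R := (-1) ^+ n * expR (- (lnS R n / 2)).

Lemma normr_altcoef n : `|altcoef n| = (Num.sqrt n.+1%:R)^-1.
Proof.
rewrite /altcoef normrM normrX normrN1 expr1n mul1r ger0_norm ?expR_ge0 //.
rewrite expRN; congr (_^-1).
have -> : n.+1%:R = expR (lnS R n / 2) ^+ 2.
  by rewrite -expRM_natl mulrC divfK // lnK ?posrE ?ltr0Sn.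
by rewrite sqrtr_sqr ger0_norm ?expR_ge0.
Qed.

Lemma altterm_half u n : altterm (2^-1 +i* u) n =
  (altcoef n * cos (u * lnS R n)) +i* (- (altcoef n * sin (u * lnS R n))).
Proof.
rewrite /altterm /nat_cpowN -/(lnS R n).
have -> : (-1) ^+ n = ((-1) ^+ n : R)%:C :> R[i] by rewrite rmorphXn rmorphN1.
have -> : - (2^-1 +i* u) * (lnS R n)%:C = (- (lnS R n / 2)) +i* (- (u * lnS R n)).
  by apply/eqP; rewrite eq_complex /=; apply/andP; split; apply/eqP; field.
rewrite /cexp /altcoef /= cosN sinN.
by apply/eqP; rewrite eq_complex /=; apply/andP; split; apply/eqP; ring.
Qed.

Lemma sum_altterm_half u N : \sum_(0 <= n < N) altterm (2^-1 +i* u) n =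
  dcos altcoef (lnS R) N u +i* (- dsin altcoef (lnS R) N u).
Proof.
rewrite /dcos /dsin; elim: N => [|N IH].
  by rewrite big_geq // !big_ord0 oppr0.
rewrite big_nat_recr //= IH altterm_half !big_ord_recr /=.
by apply/eqP; rewrite eq_complex /= opprD !eqxx.
Qed.

Lemma sqr_normc_altsum u N :
  normc (\sum_(0 <= n < N) altterm (2^-1 +i* u) n) ^+ 2 =
  dsq altcoef (lnS R) N u.
Proof. by rewrite sum_altterm_half sqr_normcE /= sqrrN. Qed.

(** [|1 - 2^(1-s)| >= sqrt 2 - 1 >= 2/5] on the critical line, and the tail of the
    alternating series beyond [2M >= |u| - 1] is at most 5. *)
Lemma zeta_half_bound zeta u M : is_riemann_zeta zeta -> u != 0 ->
  `|u| <= (M.*2.+1)%:R ->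
  normc (zeta (2^-1 +i* u)) ^+ 2 <= 13 * (dsq altcoef (lnS R) M.*2 u + 25).
Proof.
move=> zP u0 uM; set s := 2^-1 +i* u.
have s0 : 0 <= Re s by rewrite /= invr_ge0.
set S := \sum_(0 <= n < M.*2) altterm s n.
have near : normc (etaz zeta s - S) <= 5.
  apply: (ccvg_bound (N := M) (etaz_half zP u0)) => k Mk.
  rewrite sum_pairterm_alt /S.
  have Mk2 : (M.*2 <= k.*2)%N by rewrite leq_double.
  rewrite (big_cat_nat (leq0n _) Mk2) [X in normc X]addrAC subrr add0r.
  apply: le_trans (sum_altterm_tail s0 uM Mk2) _.
  by rewrite [complex.Re s]/=; lra.
set c := cexp (- (s - 1) * (ln 2)%:C).
have c1 : 7 / 5 <= normc c.
  rewrite /c normc_cexp ReM_real ReN_eq.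
  have -> : - Re (s - 1) * ln 2 = ln 2 / 2 by rewrite [complex.Re _]/=; field.
  have : expR (ln 2 / 2) ^+ 2 = 2 :> R.
    by rewrite -expRM_natl mulrC divfK // lnK ?posrE.
  have := expR_ge0 (ln 2 / 2 : R); move: (expR _) => x x0 x2.
  by rewrite leNgt; apply/negP => x75; nra.
have lower : normc (zeta s) * (2 / 5) <= normc (etaz zeta s).
  have -> : etaz zeta s = (1 - c) * zeta s by rewrite /etaz -/c mulrBl mul1r.
  rewrite Normc.normcM mulrC ler_wpM2r ?normc_ge0 //.
  have h : normc c <= normc (c - 1) + normc 1.
    by rewrite -{1}[c](subrK 1) normcD_le.
  by rewrite normcB_sym; rewrite Normc.normc1 in h; lra.
have upper : normc (etaz zeta s) <= normc S + 5.
  rewrite -[etaz zeta s](subrK S) addrC; apply: le_trans (normcD_le _ _) _.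
  by rewrite lerD2l.
have SE := sqr_normc_altsum u M.*2; rewrite -/S in SE; rewrite -SE.
have := normc_ge0 (zeta s); have := normc_ge0 S.
move: lower upper; move: (normc (zeta s)) (normc S) (normc (etaz zeta s)).
move=> z t e h1 h2 t0 z0.
have zt : z <= 5 / 2 * (t + 5) by lra.
apply: le_trans (_ : (5 / 2 * (t + 5)) ^+ 2 <= _).
  by rewrite lerXn2r ?nnegrE //; lra.
(* The difference [13 (t^2 + 25) - (5/2 (t + 5))^2] as a sum of squares. *)
rewrite -subr_ge0 [X in 0 <= X](_ : _ =
  25 / 4 * (t - 5) ^+ 2 + 1 / 2 * t ^+ 2 + 25 / 2); last by field.
by have := sqr_ge0 (t - 5); have := sqr_ge0 t; lra.
Qed.

(** The choice [L = log N] bounds every frequency, so the mean square of [D'] is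
    at most [L^2] times the bound for [D]. *)
Lemma dmaj_altcoef_osc N (k L : R) x y :
  (1 < N)%N -> L = ln N%:R -> 0 <= k -> x <= y ->
  dmaj altcoef (lnS R) N k L y - dmaj altcoef (lnS R) N k L x
    <= (k + 2 * L) * ((y - x + 8 * N%:R) * harm R N).
Proof.
move=> N1 LE k0 xy.
have L0 : 0 < L by rewrite LE ln_gt0 // ltr1n.
have h1 : dsqprim altcoef (lnS R) N y - dsqprim altcoef (lnS R) N x
    <= 1 ^+ 2 * ((y - x + 8 * N%:R) * harm R N).
  by apply: dsqprim_osc => // n _; rewrite normr_altcoef mul1r.
have h2 : dsqprim (dwt altcoef (lnS R)) (lnS R) N y -
     dsqprim (dwt altcoef (lnS R)) (lnS R) N x
    <= L ^+ 2 * ((y - x + 8 * N%:R) * harm R N).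
  apply: dsqprim_osc => // [|n nN]; first exact: ltW.
  rewrite /dwt normrM normr_altcoef mulrC (ger0_norm (lnS_ge0 R n)).
  rewrite ler_wpM2r ?invr_ge0 ?sqrtr_ge0 // LE ler_ln ?posrE ?ltr0Sn ?ler_nat //.
  by rewrite ltr0n (ltn_trans _ N1).
rewrite expr1n mul1r in h1; move: h1 h2; rewrite /dmaj.
move: (dsqprim altcoef _ _ y) (dsqprim altcoef _ _ x) => p1 p2.
move: (dsqprim _ _ _ y) (dsqprim _ _ _ x) => q1 q2.
move: ((_ + _) * _) => W h1 h2.
have -> : (k + L) * p1 + q1 / L - ((k + L) * p2 + q2 / L) =
  (k + L) * (p1 - p2) + (q1 - q2) / L by ring.
have -> : (k + 2 * L) * W = (k + L) * W + L ^+ 2 * W / L.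
  by field; rewrite gt_eqF.
by rewrite lerD // ?ler_wpM2l ?ler_wpM2r ?invr_ge0 ?addr_ge0 // ltW.
Qed.

Lemma sum_windows (F : R -> R) T K :
  \sum_(0 <= k < K.+1) (F (T + k%:R + 2) - F (T + k%:R - 1)) =
  (F (T + K%:R) - F (T - 1)) + (F (T + K%:R + 1) - F T) +
  (F (T + K%:R + 2) - F (T + 1)).
Proof.
elim: K => [|K IH]; first by rewrite big_nat1 addr0; ring.
rewrite big_nat_recr //= IH -[K.+1%:R]natr1.
have -> : T + (K%:R + 1) - 1 = T + K%:R by ring.
have -> : T + (K%:R + 1) = T + K%:R + 1 by ring.
have -> : T + K%:R + 1 + 1 = T + K%:R + 2 by ring.
by ring.
Qed.

(** [lebesgue_measure] is defined on all sets as an outer measure, hence monotone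
    and subadditive there. *)
Lemma measure_unit_cover (T : R) (bad : nat -> bool) n (A : set R) :
  (forall t, A t -> exists k, [/\ (k < n)%N, bad k & T + k%:R <= t <= T + k%:R + 1]) ->
  (lebesgue_measure A <= (\sum_(0 <= k < n) (bad k)%:R)%:E)%E.
Proof.
elim: n A => [|n IH] A hA.
  have -> : A = set0 by rewrite -subset0 => t /hA [k []].
  by rewrite measure0 big_geq.
pose A1 := [set t | exists k, [/\ (k < n)%N, bad k & T + k%:R <= t <= T + k%:R + 1]].
pose J := if bad n then `[T + n%:R, T + n%:R + 1]%classic else set0.
have sub : A `<=` A1 `|` J.
  move=> t /hA [k [kn bk tk]]; move: kn; rewrite ltnS leq_eqVlt => /orP[/eqP e|kn].
    by right; rewrite /J -e bk /= in_itv.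
  by left; exists k.
apply: le_trans (_ : (lebesgue_measure A1 + lebesgue_measure J <= _)%E).
  apply: le_trans (outer_measureU2 _ _ _).
  exact: le_outer_measure.
rewrite big_nat_recr //= EFinD; apply: leeD; first by apply: IH => t [k h]; exists k.
rewrite /J; case: (bad n); last by rewrite measure0.
rewrite lebesgue_measure_itv /= lte_fin ltrDl ltr01 -EFinD lee_fin.
by lra.
Qed.

(** The length [2 (K + 2)] exceeds every [u] at distance at most 1 from [[T, 2T]]
    when [K] is the integer part of [T], and [3^-1] is the inverse of the length
    of the windows below. *)
Definition winmaj K : R -> R :=
  dmaj altcoef (lnS R) K.+2.*2 3^-1 (ln K.+2.*2%:R).

(** If [t] lies in the [k]-th unit interval from [T], the points [u] with
    [|t - u| <= 1] lie in the window of length 3 considered here. *)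
Lemma zeta_window_bound zeta T K k u : is_riemann_zeta zeta ->
  4 <= T -> K%:R <= T -> T < K%:R + 1 -> (k <= K)%N ->
  T + k%:R - 1 <= u <= T + k%:R + 2 ->
  normc (zeta (2^-1 +i* u)) ^+ 2 <=
    13 * (winmaj K (T + k%:R + 2) - winmaj K (T + k%:R - 1) + 25).
Proof.
move=> zP T4 KT TK kK uu.
have /andP[ku uk] := uu.
have k0 : 0 <= k%:R :> R by [].
have kK' : k%:R <= K%:R :> R by rewrite ler_nat.
have NE : (K.+2.*2)%:R = 2 * K%:R + 4 :> R.
  by rewrite -mul2n natrM -!natr1; ring.
have u0 : 0 < u by lra.
have uN : `|u| <= (K.+2.*2).+1%:R by rewrite -natr1 NE gtr0_norm //; lra.
apply: le_trans (zeta_half_bound zP (lt0r_neq0 u0) uN) _.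
rewrite ler_wpM2l // lerD2r.
have L0 : 0 < ln (K.+2.*2)%:R :> R by rewrite ln_gt0 // ltr1n.
have xy : T + k%:R - 1 < T + k%:R + 2 by lra.
have := dsq_sobolev altcoef (lnS R) (K.+2.*2) L0 xy uu.
have -> : T + k%:R + 2 - (T + k%:R - 1) = 3 by ring.
exact.
Qed.

(** The windows overlap three times, so the sum telescopes to three increments
    over intervals of length at most [T + 1], each [O(T (log T)^2)]. *)
Lemma sum_dmaj_windows T K : 4 <= T -> expR 1 <= T -> K%:R <= T -> T < K%:R + 1 ->
  \sum_(0 <= k < K.+1) (winmaj K (T + k%:R + 2) - winmaj K (T + k%:R - 1))
    <= 1014 * (T * ln T ^+ 2).
Proof.
move=> T4 Te KT TK.
set l := ln T; pose N := K.+2.*2; pose L := ln (N%:R : R).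
have l1 : 1 <= l by rewrite -(expRK 1) ler_ln // posrE ?expR_gt0 //; lra.
have K0 : 0 <= K%:R :> R by [].
have NE : N%:R = 2 * K%:R + 4 :> R.
  by rewrite /N -mul2n natrM -!natr1; ring.
have N1 : (1 < N)%N by [].
have NT : N%:R <= 3 * T by lra.
have L0 : 0 < L by rewrite ln_gt0 // ltr1n.
have Ll : L <= 2 * l.
  have -> : 2 * l = ln (T ^+ 2) by rewrite lnXn ?mulr_natl //; lra.
  rewrite ler_ln ?posrE ?exprn_gt0 ?ltr0n ?(ltn_trans _ N1) //; last by lra.
  by apply: le_trans NT _; rewrite expr2 ler_wpM2r //; lra.
have Hl : harm R N <= 3 * l.
  have : harm R N <= 1 + L by rewrite -(prednK (ltnW N1)) harm_le_ln.
  by lra.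
(* [1/3 + 2 L <= 13/3 l] as [L <= 2 l] and [1 <= l]; and [T + 1 + 8 N <= 26 T]. *)
have osc x y : x <= y -> y - x <= T + 1 ->
    winmaj K y - winmaj K x <= 13 / 3 * l * (26 * T * (3 * l)).
  move=> xy yx; apply: le_trans (dmaj_altcoef_osc N1 erefl _ xy) _ => //.
  have N0 : 0 <= N%:R :> R by [].
  rewrite -/L ler_pM //.
  - by lra.
  - by rewrite mulr_ge0 ?harm_ge0 //; lra.
  - by lra.
  - by rewrite ler_pM ?harm_ge0 //; lra.
rewrite sum_windows.
have h1 := osc (T - 1) (T + K%:R); have h2 := osc T (T + K%:R + 1).
have h3 := osc (T + 1) (T + K%:R + 2).
rewrite [leRHS](_ : _ = 13 / 3 * l * (26 * T * (3 * l)) +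
  13 / 3 * l * (26 * T * (3 * l)) + 13 / 3 * l * (26 * T * (3 * l))); last by field.
by rewrite !lerD ?h1 ?h2 ?h3 //; lra.
Qed.

Lemma window_majorant zeta T : is_riemann_zeta zeta -> 4 <= T -> expR 1 <= T ->
  exists K (beta : nat -> R), [/\ T < K%:R,
    \sum_(0 <= k < K) beta k <= 14000 * (T * ln T ^+ 2) &
    forall k u, (k < K)%N -> T + k%:R - 1 <= u <= T + k%:R + 2 ->
      normc (zeta (2^-1 +i* u)) ^+ 2 <= beta k].
Proof.
move=> zP T4 Te.
have T0 : 0 <= T by lra.
have /andP[KT TK] := Num.Theory.truncn_itv T0.
move: (Num.truncn T) KT TK => K KT TK; rewrite -natr1 in TK.
exists K.+1, (fun k => 13 * (winmaj K (T + k%:R + 2) - winmaj K (T + k%:R - 1) + 25)).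
split; first by rewrite -natr1.
  rewrite -mulr_sumr big_split /= sumr_const_nat subn0 -[25 *+ _]mulr_natl -natr1.
  have l1 : 1 <= ln T by rewrite -(expRK 1) ler_ln // posrE ?expR_gt0 //; lra.
  (* [13 * 1014 + 13 * 25 * (1 + 1/4) <= 14000], the second term being at most
     [13 * 25 * (T + 1)] in total. *)
  have Tl : T <= T * ln T ^+ 2 by rewrite ler_peMr ?exprn_ege1.
  have := sum_dmaj_windows T4 Te KT TK => h.
  move: (T * ln T ^+ 2) (\sum_(_ <= _ < _) _) Tl h => S1 S2 Tl h.
  by lra.
by move=> k u kK; apply: zeta_window_bound.
Qed.

(** Chebyshev's inequality for the counting measure on the unit intervals: an
    interval that contains a bad [t] has [beta k > (V log T)^2]. *)
Lemma prob_large_values zeta T V : is_riemann_zeta zeta ->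
  4 <= T -> expR 1 <= T -> 0 < V ->
  prob_unif T [set t | max_near zeta t > V * ln T] <= 14000 / V ^+ 2.
Proof.
move=> zP T4 Te V0.
have T0 : 0 < T by lra.
have [K [beta [TK sumbeta pointwise]]] := window_majorant zP T4 Te.
have l0 : 0 < ln T by rewrite ln_gt0 //; lra.
set c := V * ln T; have c0 : 0 < c by rewrite mulr_gt0.
pose bad k := c ^+ 2 < beta k.
have bad_le k : (k < K)%N -> (bad k)%:R <= beta k / c ^+ 2.
  move=> kK; rewrite /bad; case: ltP => h /=.
    by rewrite ler_pdivlMr ?exprn_gt0 // mul1r ltW.
  rewrite divr_ge0 ?sqr_ge0 //.
  apply: le_trans (pointwise k (T + k%:R) kK _); first exact: sqr_ge0.
  by rewrite gerDl lerDl oppr_le0 ler01 ler0n.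
have cover t : (`[T, 2 * T]%classic `&` [set t | max_near zeta t > c]) t ->
    exists k, [/\ (k < K)%N, bad k & T + k%:R <= t <= T + k%:R + 1].
  move=> [/=]; rewrite in_itv /= => /andP[Tt t2T] big.
  have tT0 : 0 <= t - T by rewrite subr_ge0.
  have /andP[kt tk] := Num.Theory.truncn_itv tT0.
  move: (Num.truncn _) kt tk => k kt tk; rewrite -natr1 in tk.
  have {}kt : T + k%:R <= t by rewrite addrC -lerBrDr.
  have {}tk : t < T + k%:R + 1 by rewrite -addrA addrC -ltrBlDr.
  exists k; split; last by rewrite kt ltW.
    rewrite -(ltr_nat R); apply: le_lt_trans TK.
    by rewrite -(lerD2l T) (le_trans kt) // -mulr2n -mulr_natl.
  rewrite /bad ltNge; apply/negP => hbad.
  move: big; rewrite ltNge => /negP; apply.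
  rewrite /max_near; apply: ge_sup.
    by exists (normc (zeta (2^-1 +i* t))), t => //=; rewrite subrr normr0.
  move=> _ [u /= tu <-].
  rewrite -ler_sqr ?nnegrE ?normc_ge0 ?(ltW c0) //.
  apply: le_trans hbad; apply: pointwise.
    rewrite -(ltr_nat R); apply: le_lt_trans TK.
    by rewrite -(lerD2l T) (le_trans kt) // -mulr2n -mulr_natl.
  move: tu; rewrite ler_norml => /andP[h1 h2].
  by clear - kt tk h1 h2; apply/andP; split; lra.
have meas := measure_unit_cover cover.
rewrite /prob_unif -/c.
have fineb : fine (lebesgue_measure (`[T, 2 * T] `&`
    [set t | max_near zeta t > c])) <= \sum_(0 <= k < K) (bad k)%:R.
  rewrite -lee_fin fineK //.
  by rewrite ge0_fin_numE ?outer_measure_ge0 //; apply: le_lt_trans meas (ltry _).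
rewrite mulrC ler_pdivrMr //; apply: le_trans fineb _.
apply: le_trans (_ : \sum_(0 <= k < K) beta k / c ^+ 2 <= _).
  by rewrite big_nat [leRHS]big_nat; apply: ler_sum => k /andP[_]; exact: bad_le.
rewrite -mulr_suml ler_pdivrMr ?exprn_gt0 //; apply: le_trans sumbeta _.
rewrite le_eqVlt; apply/orP; left; apply/eqP; rewrite /c exprMn.
by field; rewrite gt_eqF.
Qed.

End LargeValues.

Theorem proposition2p1 (R : realType) (zeta : R[i] -> R[i])
    (zetaP : is_riemann_zeta zeta) (V : R -> R)
    (V_oo : V T @[T --> +oo] --> +oo) :
  let p (T : R) : R^o := prob_unif T [set t | max_near zeta t > V T * ln T] in
  p =O_+oo (fun T : R => 1 / V T ^+ 2 : R^o) /\
  p =o_+oo (fun _ : R => 1 : R^o).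
Proof.
move=> p.
have p0 T : 0 < T -> 0 <= p T.
  move=> T0; rewrite /p /prob_unif mulr_ge0 ?invr_ge0 ?(ltW T0) //.
  by rewrite fine_ge0 // outer_measure_ge0.
have V_big (A : R) : \forall T \near +oo, A < V T.
  by move/cvgryPgt: V_oo; apply.
have [C C0 p_le] : exists2 C : R, 0 < C &
    \forall T \near +oo, `|p T| <= C / V T ^+ 2.
  exists 14000; first by rewrite ltr0n.
  near=> T; have T0 : 0 < T by near: T; exact: nbhs_pinfty_gt.
  rewrite ger0_norm ?p0 //; apply: prob_large_values => //.
  by near: T; exact: V_big.
split.
  apply/eqO_exP; exists C => //.
  by apply: filterS p_le => T; rewrite div1r normfV normrX real_normK ?num_real.
apply/eqoP => e e0; near=> T.
have h : `|p T| <= C / V T ^+ 2 by near: T; exact: p_le.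
rewrite normr1 mulr1; apply: le_trans h _.
have V1 : 1 < V T by near: T; exact: V_big.
have Ve : C / e < V T by near: T; exact: V_big.
rewrite ler_pdivrMr ?exprn_gt0 ?(lt_trans ltr01) // mulrC -ler_pdivrMr //.
apply: le_trans (ltW Ve) _; rewrite expr2 ler_peMr ?(ltW V1) //.
by rewrite ltW // (lt_trans ltr01).
Unshelve. all: by end_near. Qed.
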